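(* Let $\mathcal{C}$ be a finite family of convex sets in $\mathbb{R}^2$ satisfying the $(4,3)$-property. Then $\tau(\mathcal{C})\le 9$.
   Context: A family of sets satisfies the $(p,q)$-property if among every $p$ of its members some $q$ have a point in common. The piercing number $\tau(\mathcal{C})$ is the minimum size of a set of points meeting every member of $\mathcal{C}$. *)

(* Defs.v *)
From mathcomp Require Import all_boot all_order all_algebra finmap.
From mathcomp Require Import boolp classical_sets functions cardinality reals.
From mathcomp Require Import ereal convex.

Set Implicit Arguments.
Unset Strict Implicit.
Unset Printing Implicit Defensive.

Import Order.TTheory GRing.Theory Num.Theory.
Local Open Scope classical_set_scope.
Local Open Scope ring_scope.

Definition has_pq_property (T : Type) (p q : nat) (C : {fset (set T)}) : Prop :=
  forall P : {fset (set T)}, (P `<=` C)%fset -> #|` P| = p ->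
    exists Q : {fset (set T)},
      [/\ (Q `<=` P)%fset, #|` Q| = q & \bigcap_(A in [set` Q]) A !=set0].

Definition pierces (T : choiceType) (P : {fset T}) (C : {fset (set T)}) : Prop :=
  forall A : set T, A \in C -> [set` P] `&` A !=set0.

(* The value lies in the extended reals so that it is +oo when no finite set
   meets every member, i.e. when C has an empty member. Otherwise the infimum
   is a minimum, see [piercing_numberE]. *)
Definition piercing_number (R : realType) (d : nat)
    (C : {fset (set 'rV[R]_d)}) : \bar R :=
  ereal_inf [set (#|` P|%:R)%:E | P in [set P | pierces P C]].

Lemma piercing_numberE (R : realType) (d : nat) (C : {fset (set 'rV[R]_d)}) :
  (forall A, A \in C -> A !=set0) ->
  exists P : {fset 'rV[R]_d},
    [/\ pierces P C, piercing_number C = (#|` P|%:R)%:E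
      & forall Q, pierces Q C -> (#|` P| <= #|` Q|)%N].
Proof.
move=> C0.
have : exists n, `[< exists2 P, pierces P C & #|` P| = n >].
  pose f (A : set 'rV[R]_d) := xget 0 A.
  exists #|` [fset f A | A in C]%fset|; apply/asboolP.
  exists [fset f A | A in C]%fset => // A AC.
  have [x Ax] := C0 _ AC; exists (f A); split; last exact: (xgetI 0 Ax).
  by rewrite /= in_imfset.
move=> /[dup] exP; case: (ex_minnP exP) => n /asboolP[P PC <-] Pmin _.
have minP Q : pierces Q C -> (#|` P| <= #|` Q|)%N.
  by move=> QC; apply: Pmin; apply/asboolP; exists Q.
exists P; split => //; apply/eqP; rewrite eq_le; apply/andP; split.
  by apply: ereal_inf_lbound; exists P.
by apply: le_ereal_inf_tmp => _ [Q QC <-]; rewrite lee_fin ler_nat minP.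
Qed.

(* Main.v *)
Require Import Defs.
From mathcomp Require Import all_boot all_order all_algebra finmap.
From mathcomp Require Import boolp classical_sets functions cardinality reals.
From mathcomp Require Import ereal convex.
From mathcomp Require Import interval_inference topology normedtype.
From mathcomp Require Import zify ring lra.

(* Replace the sets by compact convex hulls of chosen intersection points, and
   thicken them slightly without creating new intersections; a face is a
   subfamily with a common point. A cross is a pair of lines, with four open
   quadrants. If for each quadrant the thickened sets missing it are covered by
   two faces, the remaining sets meet all four open quadrants, hence contain the
   centre of the cross by convexity, and nine faces cover the family.
   To find such a cross, consider the parabola below the family together with
   the crosses made of a vertical line through its point b and the chord ac, for
   parameters a <= b <= c in [-1, 1]. The quadrants vanish respectively when
   a = -1, a = b, b = c, c = 1. If no cross were good, colour each (a, b, c) by a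
   quadrant whose missing sets are not covered by two faces: Scarf's lemma and
   compactness give a single cross bad for all four quadrants. The (4,3)-property
   excludes this: for a nondegenerate cross, two sets missing a quadrant and not
   meeting on its lines, together with one missing the opposite quadrant, force
   the sets missing a third quadrant to meet pairwise on two lines, whence two
   faces; for a degenerate cross, two vertical lines separate two subfamilies. *)

Set Implicit Arguments.
Unset Strict Implicit.
Unset Printing Implicit Defensive.

Import Order.TTheory GRing.Theory Num.Theory.
Import numFieldTopology.Exports numFieldNormedType.Exports.

(** * Scarf's lemma *)

Section Scarf.
Import fintype boot.finset.
Variables (T I : finType) (r : I -> T -> nat) (c : T -> I) (t0 : T).
Hypothesis r_inj : forall i, injective (r i).
Implicit Types (s : {set T}) (C : {set I}) (i j k l : I) (x y : T).

(** Limits and the (4,3)-property pull in opposite directions. In a limit of crosses the quadrants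
    must be open: a set reaching an open quadrant still reaches it for nearby parameters, so that
    avoiding it survives the limit. The (4,3)-argument needs strict signs, hence sets that miss
    closed quadrants. The thickening reconciles the two: if a thickened set avoids an open nonempty
    quadrant, the set itself misses the closed one. The centre of the cross is only found in
    thickened sets, which is harmless since thickening creates no new face. The parabola serves to
    index crosses by a simplex: the gaps between -1, a, b, c, 1 are nonnegative with sum 2, and on
    the facet where a gap vanishes the matching quadrant has no point above the parabola. All sets
    avoid it there, so it is a legitimate colour on that facet unless two faces cover the whole
    family, in which case nothing is left to prove. This is the boundary condition of a KKM-type
    theorem, whose combinatorial core is supplied by Scarf's lemma. *)

Definition below i s y := [forall x in s, r i y <= r i x].

(** Scarf's condition on primitive sets: for nonempty s, no point exceeds the minimum over s in all
    rankings of C at once. *)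
Definition dominant s C := [forall y, [exists i in C, below i s y]].

Lemma belowP i s y : reflect {in s, forall x, r i y <= r i x} (below i s y).
Proof. exact: forall_inP. Qed.

Lemma dominantP s C :
  reflect (forall y, exists2 i, i \in C & below i s y) (dominant s C).
Proof.
apply: (iffP forallP) => H y; have := H y; first by move/exists_inP.
by move=> ?; apply/exists_inP.
Qed.

Lemma below_sub i s s' y : s \subset s' -> below i s' y -> below i s y.
Proof. by move=> /subsetP ss' /belowP H; apply/belowP => x /ss'/H. Qed.

Lemma dominant_sub s s' C C' :
  s \subset s' -> C' \subset C -> dominant s' C' -> dominant s C.
Proof.
move=> ss' /subsetP CC' /dominantP H; apply/dominantP => y.
by have [i /CC' iC] := H y; exists i => //; exact: below_sub ss' _.
Qed.

Lemma below_uniq i s x y : x \in s -> y \in s ->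
  below i s x -> below i s y -> x = y.
Proof.
move=> xs ys /belowP xP /belowP yP; apply: (r_inj (i := i)).
by apply/eqP; rewrite eqn_leq xP ?yP.
Qed.

(** Applied to the points of s themselves, dominance makes each of them the lowest of s for some
    index of C; as rankings are injective, distinct points get distinct indices. *)
Lemma dominant_sel s C : dominant s C ->
  exists2 f : T -> I, {in s, forall x, f x \in C /\ below (f x) s x} &
    {in s &, injective f}.
Proof.
move=> /dominantP H.
have F x : {i | (i \in C) && below i s x}.
  by apply: sigW; have [i iC ix] := H x; exists i; rewrite iC.
exists (fun x => sval (F x)) => [x xs|x y xs ys].
  by case: (F x) => i /= /andP[].
case: (F x) (F y) => i /= /andP[_ ix] [j /= /andP[_ jy]] ij.
by rewrite -ij in jy; exact: below_uniq ix jy.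
Qed.

Lemma room_sel s C : dominant s C -> #|s| = #|C| ->
  exists2 f : T -> I, {in s, forall x, below (f x) s x} &
  forall i, i \in C -> exists2 x, x \in s & f x = i.
Proof.
case/dominant_sel => f fC finj sC; exists f => [x xs|i iC].
  by have [] := fC x xs.
have : f @: s = C.
  apply/eqP; rewrite eqEcard (card_in_imset finj) sC leqnn andbT.
  by apply/subsetP => _ /imsetP[x xs ->]; have [] := fC x xs.
by move/setP/(_ i); rewrite iC => /imsetP[x xs ->]; exists x.
Qed.

(** In a room the assignment of [room_sel] is onto by counting, so each index already has its own
    lowest point. *)
Lemma room_inj s C i j x : dominant s C -> #|s| = #|C| ->
  i \in C -> j \in C -> x \in s -> below i s x -> below j s x -> i = j.
Proof.
move=> dom sC iC jC xs ix jx; have [f fP fS] := room_sel dom sC.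
have [y ys yi] := fS i iC; have [z zs zj] := fS j jC.
rewrite -yi -zj; congr f.
have /(below_uniq xs ys ix) <- : below i s y by rewrite -yi fP.
by have /(below_uniq xs zs jx) <- : below j s z by rewrite -zj fP.
Qed.

Definition room (p : {set T} * {set I}) :=
  dominant p.1 p.2 && (#|p.1| == #|p.2|).

Definition door (p : {set T} * {set I}) :=
  dominant p.1 p.2 && (#|p.2| == #|p.1|.+1).

Definition incident (d p : {set T} * {set I}) :=
  (d.1 \subset p.1) && (p.2 \subset d.2).

(** The cardinalities differ by one along [#|t| <= #|s| = #|C| <= #|D| = #|t|.+1], so exactly one of
    the two inclusions is an equality. *)
Lemma incidentP d p : door d -> room p -> incident d p ->
  (exists2 k, k \in d.2 & p = (d.1, d.2 :\ k)) \/
  (exists2 y, y \notin d.1 & p = (y |: d.1, d.2)).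
Proof.
case: d p => [t D] [s C] /andP[/= _ /eqP Dt] /andP[/= _ /eqP sC].
move=> /andP[/= ts CD].
have [ts'|] := leqP #|s| #|t|.
  have /eqP st : t == s by rewrite eqEcard ts.
  left; have : 0 < #|D :\: C|.
    by rewrite cardsD (setIidPr CD) -sC Dt st subSnn.
  case/card_gt0P => k; rewrite inE => /andP[kC kD]; exists k => //; rewrite st.
  congr pair; apply/eqP; rewrite eqEcard subsetD1 CD kC /= -sC -st.
  by move: Dt; rewrite (cardsD1 k) kD add1n => -[->].
move=> lt_ts; have /eqP CE : C == D by rewrite eqEcard CD Dt -sC.
right; have : 0 < #|s :\: t|.
  by rewrite cardsD (setIidPr ts) subn_gt0.
case/card_gt0P => y; rewrite inE => /andP[yt ys]; exists y => //.
rewrite CE; congr pair; apply/eqP; rewrite eq_sym eqEcard subUset sub1set ys ts.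
by rewrite cardsU1 yt sC CE Dt add1n leqnn.
Qed.

Section InternalDoor.
Variables (t : {set T}) (D : {set I}) (x0 : T).
Hypotheses (dtD : door (t, D)) (x0t : x0 \in t).

Let dom : dominant t D. Proof. by case/andP: dtD. Qed.
Let Dt : #|D| = #|t|.+1. Proof. by case/andP: dtD => _ /eqP. Qed.

(* Two of the indices share their lowest point in t, and every other point of t
   is lowest for a single index. *)
Lemma door_pivots : exists i j, [/\ i != j, i \in D, j \in D,
    forall k, k \in [set i; j] -> {in t, forall x, exists2 l, l \in D :\ k & below l t x}
  & forall k, k \in D ->
      {in t, forall x, exists2 l, l \in D :\ k & below l t x} -> k \in [set i; j]].
Proof.
have [f fD finj] := dominant_sel dom.
have ftD : f @: t \subset D.
  by apply/subsetP => _ /imsetP[x xt ->]; have [] := fD x xt.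
have : 0 < #|D :\: f @: t|.
  by rewrite cardsD (setIidPr ftD) card_in_imset // Dt subSnn.
case/card_gt0P => i; rewrite inE => /andP[ift iD].
have DE : D = i |: f @: t.
  apply/eqP; rewrite eq_sym eqEcard subUset sub1set iD ftD cardsU1 ift.
  by rewrite card_in_imset // Dt add1n leqnn.
case: (arg_minnP (r i) x0t) => x1 x1t x1min.
have ix1 : below i t x1 by apply/belowP => y /x1min.
have fx1 := fD x1 x1t.
have if1 : i != f x1 by apply: contraNneq ift => ->; apply: imset_f.
exists i, (f x1); split=> //; first by case: fx1.
  move=> k; rewrite !inE => /orP[]/eqP -> x xt.
    exists (f x); last by case: (fD x xt).
    rewrite !inE (proj1 (fD x xt)) andbT; apply: contraNneq ift => <-.
    exact: imset_f.
  have [->|xx1] := eqVneq x x1; first by exists i => //; rewrite !inE if1.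
  exists (f x); last by case: (fD x xt).
  rewrite !inE (proj1 (fD x xt)) andbT; apply: contraNneq xx1 => /finj ->//.
move=> k kD; have := kD; rewrite {1}DE !inE => /orP[->//|/imsetP[x xt kE]].
move=> /(_ x xt)[l]; rewrite !inE => /andP[lk lD] lx; have := lD.
rewrite DE !inE => /orP[/eqP li|/imsetP[y yt lE]].
  by rewrite li in lx; rewrite kE (below_uniq xt x1t lx ix1) eqxx orbT.
have ly : below l t y by rewrite lE; case: (fD y yt).
by move: lk; rewrite kE lE (below_uniq xt yt lx ly) eqxx.
Qed.

(* The room behind the door (t, D) reached by giving up the index k. *)
Lemma door_room k : k \in D ->
    {in t, forall x, exists2 l, l \in D :\ k & below l t x} ->
  exists p, [/\ room p, incident (t, D) p &
    forall q, room q ->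
      (q = (t, D :\ k) \/ exists y, [/\ q = (y |: t, D), y \notin t &
                                       below k (y |: t) y]) <-> q = p].
Proof.
move=> kD kred.
(* The points at which dominance fails once k is given up. If there are none, k is dropped;
   otherwise the point of M highest in ranking k is added. *)
pose M := [set y | [forall l in D :\ k, ~~ below l t y]].
have MP y : reflect (forall l, l \in D :\ k -> ~~ below l t y) (y \in M).
  by rewrite inE; apply: forall_inP.
have Mt y : y \in M -> y \notin t.
  by move/MP => yM; apply/negP => /kred[l lD ly]; move: (yM l lD); rewrite ly.
have Mk y : y \in M -> below k t y.
  move=> /MP yM; have [l lD ly] := dominantP _ _ dom y.
  have [<-//|lk] := eqVneq l k; suff : ~~ below l t y by rewrite ly.
  by apply: yM; rewrite !inE lk.
have cardD : #|D :\ k| = #|t|.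
  by move: Dt; rewrite (cardsD1 k) kD add1n => -[].
have domM : dominant t (D :\ k) -> M = set0.
  move=> H; apply/setP => y; rewrite [RHS]inE; apply/negP => /MP yM.
  by have [l lD ly] := dominantP _ _ H y; move: (yM l lD); rewrite ly.
have inM y : room (y |: t, D) -> y \notin t -> below k (y |: t) y -> y \in M.
  case/andP => /= domy /eqP cy yt ky; apply/MP => l.
  rewrite !inE => /andP[lk lD]; apply: contra lk => ly; apply/eqP.
  apply: (room_inj domy cy lD kD (setU11 _ _) _ ky).
  by apply/belowP => x; rewrite !inE => /predU1P[->//|]; exact/belowP.
have maxM y z : room (y |: t, D) -> y \notin t -> below k (y |: t) y ->
    z \in M -> r k z <= r k y.
  move=> ry yt ky /MP zM; case/andP: ry => /= /dominantP/(_ z)[l lD lz] _.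
  have [<-|lk] := eqVneq l k; first by move/belowP: lz => /(_ y (setU11 _ _)).
  suff /negP[] : ~~ below l t z; first exact: below_sub (subsetUr _ _) lz.
  by apply: zM; rewrite !inE lk.
have [M0|[y1 y1M]] := set_0Vmem M.
  exists (t, D :\ k); split.
  - apply/andP; split; last by rewrite /= cardD.
    apply/dominantP => y; have : y \notin M by rewrite M0 inE.
    rewrite inE negb_forall_in => /exists_inP[l lD].
    by rewrite negbK => ly; exists l.
  - by rewrite /incident /= subxx subD1set.
  - move=> q rq; split; last by move=> ->; left.
    case=> // -[y [qE yt ky]]; rewrite qE in rq.
    by have := inM y rq yt ky; rewrite M0 inE.
case: (arg_maxnP (r k) y1M) => y yM ymax.
have yt := Mt y yM.
have ky : below k (y |: t) y.
  apply/belowP => x; rewrite !inE => /predU1P[->//|].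
  exact/belowP/Mk.
exists (y |: t, D); split.
- apply/andP; split; last by rewrite /= cardsU1 yt Dt.
  apply/dominantP => z /=; have [zM|] := boolP (z \in M).
    exists k => //; apply/belowP => x; rewrite !inE => /predU1P[->|].
      exact: ymax.
    exact/belowP/Mk.
  rewrite inE negb_forall_in => /exists_inP[l lD].
  rewrite negbK => lz; exists l; first by move: lD; rewrite inE => /andP[].
  apply/belowP => x; rewrite !inE => /predU1P[->|]; last exact/belowP.
  have /MP/(_ l lD) := yM; rewrite negb_forall_in => /exists_inP[w wt].
  rewrite -ltnNge => /ltnW; apply: leq_trans.
  by move/belowP: lz; apply.
- by rewrite /incident /= subsetUr subxx.
move=> q rq; split; last by move=> ->; right; exists y.
case=> [qE|[z [qE zt kz]]].
  rewrite qE in rq; case/andP: rq => /domM M0.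
  by have : y \in M := yM; rewrite M0 in_set0.
rewrite qE in rq *; congr (_ |: _, _); apply: (r_inj (i := k)); apply/eqP.
by rewrite eqn_leq (maxM z y) // andbT; apply: ymax; exact: inM.
Qed.

Lemma card_internal_door : #|[set p | room p && incident (t, D) p]| = 2.
Proof.
have [i [j [ij iD jD redP redI]]] := door_pivots.
have [p [rp ip pE]] := door_room iD (redP i (set21 _ _)).
have [q [rq iq qE]] := door_room jD (redP j (set22 _ _)).
suff [E pq] : [set p | room p && incident (t, D) p] = [set p; q] /\ p != q.
  by rewrite E cards2 pq.
split.
  apply/setP => u; rewrite !inE; apply/andP/orP => [[ru iu]|]; last first.
    by case=> /eqP ->; split.
  have [k [kD ku kred]] : exists k, [/\ k \in D,
      u = (t, D :\ k) \/ exists y, [/\ u = (y |: t, D), y \notin t &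
                                       below k (y |: t) y]
      & {in t, forall x, exists2 l, l \in D :\ k & below l t x}].
    have [[k kD uE]|[y yt uE]] := incidentP dtD ru iu.
      exists k; split=> //; first by left.
      rewrite uE in ru; case/andP: ru => /= du _ x xt.
      by have [f fP _] := dominant_sel du; exists (f x); case: (fP x xt).
    rewrite uE in ru; case/andP: ru => /= du cu.
    have [f fP finj] := dominant_sel du.
    have yU := setU11 y t; exists (f y); split; first by case: (fP y yU).
      by right; exists y; split=> //; case: (fP y yU).
    move=> x xt; have xU : x \in y |: t by rewrite inE xt orbT.
    exists (f x); last by apply: (below_sub (subsetUr [set y] t)); case: (fP x xU).
    rewrite !inE (proj1 (fP x xU)) andbT; apply: contraNneq yt.
    by move/(finj _ _ xU yU) => <-.
  have := redI k kD kred; rewrite !inE => /orP[]/eqP kE; rewrite kE in ku.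
    by left; apply/eqP/pE.
  by right; apply/eqP/qE.
apply/eqP => pq.
have /(pE _ rp).2 Hi : p = p by []; have := (qE p rp).2 pq.
have cardDN k : k \in D -> (t, D :\ k) <> (t, D).
  by move=> kD [] /setP/(_ k); rewrite !inE kD eqxx.
case: Hi => [pi|[y [py yt iy]]] [pj|[z [pz zt jz]]].
- move: pi; rewrite pj => -[] /setP/(_ i); rewrite !inE iD eqxx (negPf ij).
  by [].
- by move: pi; rewrite pz => -[] _ /setP/(_ i); rewrite !inE iD eqxx.
- by move: pj; rewrite py => -[] _ /setP/(_ j); rewrite !inE jD eqxx.
have yz : y = z.
  move: py; rewrite pz => -[] /setP/(_ z); rewrite !inE eqxx (negPf zt) !orbF.
  by move=> /esym/eqP ->.
rewrite -yz in jz; rewrite py in rp; case/andP: rp => /= dy /eqP cy.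
by move/eqP: ij; apply; apply: (room_inj dy cy iD jD (setU11 _ _) iy jz).
Qed.

End InternalDoor.

(** The analogue of an almost fully labelled facet in Sperner's lemma. A door has one index more
    than points, so the equation also makes c injective on [d.1]. *)
Definition typed i0 (d : {set T} * {set I}) :=
  [&& door d, i0 \in d.2 & c @: d.1 == d.2 :\ i0].

(** The room is forced to be the single point that is highest in ranking [i0], since all points have
    to be below it. *)
Lemma card_external_door i0 :
  #|[set p | room p && incident (set0, [set i0]) p]| = 1.
Proof.
case: (arg_maxnP (r i0) (isT : xpredT t0)) => y _ ymax.
have ry : room ([set y], [set i0]).
  rewrite /room /= !cards1 eqxx andbT; apply/dominantP => x; exists i0.
    exact: set11.
  by apply/belowP => z; rewrite inE => /eqP ->; apply: ymax.
suff -> : [set p | room p && incident (set0, [set i0]) p] =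
    [set ([set y], [set i0])] by rewrite cards1.
apply/setP => -[s C]; rewrite !inE; apply/andP/eqP => [[]|->]; last first.
  by rewrite ry /incident /= sub0set subxx.
case/andP => /= ds sC /andP[/= _ CD]; have [i iC iy] := dominantP _ _ ds y.
have CE : C = [set i0].
  by apply/eqP; rewrite eqEsubset CD sub1set; move/subsetP: CD => /(_ i iC);
     rewrite inE => /eqP <-.
rewrite CE in iC sC *; rewrite inE in iC; rewrite (eqP iC) cards1 in iy sC.
have /cards1P[x sE] := sC; congr pair; rewrite sE; congr [set _].
move: iy; rewrite sE => /belowP/(_ x (set11 x)) yx.
by apply: (r_inj (i := i0)); apply/eqP; rewrite eqn_leq yx andbT; exact: ymax.
Qed.

Lemma odd_typed_room i0 d : typed i0 d ->
  odd #|[set p | room p && incident d p]| = (d == (set0, [set i0])).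
Proof.
case: d => [t D] /and3P[/= dd iD cD].
have [t_0|[x xt]] := set_0Vmem t; last first.
  rewrite (card_internal_door dd xt); case: eqP => // -[tE].
  by rewrite tE inE in xt.
have DE : D = [set i0].
  rewrite t_0 imset0 in cD; apply/eqP; rewrite eqEsubset sub1set iD andbT.
  by rewrite -setD_eq0 eq_sym.
by rewrite t_0 DE card_external_door eqxx.
Qed.

(* A room which is not colourful has no typed door, or exactly two. *)
Lemma even_typed_door i0 p : room p -> c @: p.1 != p.2 ->
  ~~ odd #|[set d | typed i0 d && incident d p]|.
Proof.
case: p => s C /= rs cs; have /andP[/= ds /eqP sC] := rs.
have cardDs y : y \in s -> i0 \in C -> #|s :\ y| = #|C :\ i0|.
  by move=> ys iC; move: sC; rewrite (cardsD1 y s) ys (cardsD1 i0 C) iC => -[].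
have two d d' : d != d' -> typed i0 d && incident d (s, C) ->
    typed i0 d' && incident d' (s, C) ->
    (forall e, typed i0 e && incident e (s, C) -> e \in [set d; d']) ->
    ~~ odd #|[set d | typed i0 d && incident d (s, C)]|.
  move=> dd' td td' H.
  suff -> : [set d | typed i0 d && incident d (s, C)] = [set d; d'].
    by rewrite cards2 dd'.
  apply/setP => e; rewrite inE; apply/idP/idP; first exact: H.
  by rewrite !inE => /orP[]/eqP ->.
have doorD y : y \in s -> door (s :\ y, C).
  move=> ys; rewrite /door /= (dominant_sub (subD1set s y) (subxx C)) //=.
  by move: sC; rewrite (cardsD1 y) ys => <-.
have incD y : incident (s :\ y, C) (s, C).
  by rewrite /incident /= subD1set subxx.
have inv e : typed i0 e -> incident e (s, C) ->
    (exists2 k, k \notin C & e = (s, k |: C)) \/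
    (exists2 y, y \in s & e = (s :\ y, C)).
  case: e => t D /and3P[dtD _ _] inc.
  have [[k kD [-> ->]]|[y yt [-> ->]]] := incidentP dtD rs inc.
    by left; exists k; rewrite ?setD11 //= setD1K.
  by right; exists y; rewrite ?setU11 //= setU1K.
(* A typed door with an extra index k makes c injective on s; its twin omits the point of colour
   k. *)
have big k : i0 \in C -> k \notin C -> c @: s = (k |: C) :\ i0 ->
    ~~ odd #|[set d | typed i0 d && incident d (s, C)]|.
  move=> iC kC cE; have ki : k != i0 by apply: contraNneq kC => ->.
  have : k \in c @: s by rewrite cE !inE ki eqxx.
  case/imsetP => x xs kE.
  have cinj : {in s &, injective c}.
    apply/imset_injP; rewrite cE sC; apply/eqP.
    have := cardsD1 i0 (k |: C); rewrite cardsU1 kC !inE iC orbT => /eqP.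
    by rewrite eqn_add2l => /eqP.
  have cx : c @: (s :\ x) = C :\ i0.
    apply/setP => j; apply/imsetP/idP => [[z]|].
      rewrite !inE => /andP[zx zs] ->.
      have : c z \in (k |: C) :\ i0 by rewrite -cE imset_f.
      rewrite !inE => /andP[-> /predU1P[]] // czk.
      by case/eqP: zx; apply: cinj => //; rewrite czk.
    rewrite !inE => /andP[ji jC].
    have : j \in c @: s by rewrite cE !inE ji jC orbT.
    case/imsetP => z zs jE; exists z => //; rewrite !inE zs andbT.
    by apply: contraNneq kC => zx; rewrite kE -zx -jE.
  apply: (two (s, k |: C) (s :\ x, C)).
  - by apply/eqP => -[_ /setP/(_ k)]; rewrite !inE eqxx (negPf kC).
  - rewrite /typed /incident /= subxx subsetUr cE eqxx !inE iC orbT !andbT.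
    rewrite /door /= cardsU1 kC sC eqxx andbT.
    exact: dominant_sub (subxx s) (subsetUr _ _) ds.
  - by rewrite /typed /= doorD // iC cx eqxx incD.
  - move=> e /andP[te /(inv e te)[[l lC eE]|[z zs eE]]]; move: te.
      rewrite eE => /and3P[_ _ /= /eqP]; rewrite cE => /setP/(_ k).
      rewrite !inE ki eqxx (negPf kC) !orbF /= => /esym/eqP ->.
      by rewrite eqxx.
    rewrite eE => /and3P[_ _ /= /eqP/setP/(_ k)].
    rewrite !inE (negPf kC) andbF => cz; apply/orP; right.
    have -> : z = x; last by [].
    apply/eqP/negPn/negP => zx; move/negP: cz; apply; rewrite kE.
    by apply: imset_f; rewrite !inE eq_sym zx.
have [|[d]] := set_0Vmem [set d | typed i0 d && incident d (s, C)].
  by move=> ->; rewrite cards0.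
rewrite inE => /andP[td id].
have [[k kC dE]|[y ys dE]] := inv _ td id.
  have /and3P[_ /= iD /eqP cE] := td; rewrite dE /= in iD cE.
  have [ik|ik] := eqVneq i0 k.
    by case/eqP: cs; rewrite cE ik setU1K.
  by apply: (big k) => //; move: iD; rewrite !inE (negPf ik).
have /and3P[_ /= iC /eqP cE] := td; rewrite dE /= in iC cE.
have sE : c @: s = c y |: (C :\ i0).
  by rewrite -{1}(setD1K ys) imsetU1 cE.
have [cyC|cyC] := boolP (c y \in C); last first.
  apply: (big (c y)) => //; rewrite sE; apply/setP => j; rewrite !inE.
  by case: (eqVneq j (c y)) => //= ->; rewrite andbT; apply/esym;
    apply: contraNneq cyC => ->.
have cyi : c y != i0.
  by apply: contraNneq cs => cyi; rewrite sE cyi setD1K.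
(* Some other point z repeats the colour of y, and the two typed doors omit y and z respectively. *)
have : c y \in c @: (s :\ y) by rewrite cE !inE cyi.
case/imsetP => z; rewrite !inE => /andP[zy zs] cyz.
apply: (two (s :\ y, C) (s :\ z, C)).
- by apply/eqP => -[/setP/(_ y)]; rewrite !inE eqxx ys eq_sym zy.
- by rewrite -dE td id.
- rewrite /typed /= doorD // incD iC andbT -cE; apply/eqP/setP => j.
  apply/imsetP/imsetP => -[w]; rewrite !inE => /andP[ww ws] ->.
    have [wy|wy] := eqVneq w y; first by exists z; rewrite ?inE ?zy // wy.
    by exists w; rewrite // !inE wy.
  have [wz|wz] := eqVneq w z.
    by exists y; rewrite ?inE ?ys ?andbT ?[y == z]eq_sym // wz cyz.
  by exists w; rewrite // !inE wz.
- move=> e /andP[te /(inv e te)[[l lC eE]|[w ws eE]]]; move: te.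
    rewrite eE => /and3P[_ _ /= /eqP]; rewrite sE => /setP/(_ l).
    rewrite !inE eqxx (negPf lC) andbF orbF andbT.
    have -> : l != i0 by apply: contraNneq lC => ->.
    by move/eqP => lE; rewrite lE cyC in lC.
  rewrite eE => /and3P[_ _ /= /eqP cw].
  have /imset_injP winj : #|c @: (s :\ w)| == #|s :\ w|.
    by rewrite cw cardDs.
  rewrite !inE !xpair_eqE eqxx !andbT.
  have [->|wy] := eqVneq w y; first by rewrite eqxx.
  have [->|wz] := eqVneq w z; first by rewrite eqxx orbT.
  case/eqP: zy; apply: winj; rewrite ?inE ?zs ?ys ?andbT 1?eq_sym //.
Qed.

(* Double counting of incident typed doors and rooms: (set0, [set i0]) is the
   only typed door in front of exactly one room, all others separate two. *)
Theorem colourful_room : exists s C, [/\ dominant s C & c @: s = C].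
Proof.
case: (pickP (fun p => room p && (c @: p.1 == p.2))) => [p /andP[rp /eqP cp]|H].
  by exists p.1, p.2; split=> //; case/andP: rp.
pose i0 := c t0.
have cardE (U : finType) (P Q : pred U) :
    #|[set x | P x && Q x]| = \sum_(x | P x) Q x.
  rewrite -sum1dep_card big_mkcondr; apply: eq_bigr => x _.
  by case: (Q x).
have t_ext : typed i0 (set0, [set i0]).
  rewrite /typed /door /= cards0 cards1 imset0 setDv set11 !eqxx !andbT.
  apply/dominantP => y; exists i0; first exact: set11.
  by apply/belowP => x; rewrite inE.
have : odd (\sum_(d | typed i0 d) #|[set p | room p && incident d p]|).
  rewrite (bigD1 _ t_ext) /= card_external_door oddD /=.
  elim/big_ind: _ => // [m n|d /andP[td dN]]; last first.
    by rewrite (odd_typed_room td) (negPf dN).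
  by rewrite oddD; case: (odd m); case: (odd n).
rewrite (eq_bigr _ (fun d _ => cardE _ room (incident d))) exchange_big /=.
suff /negPf -> : ~~ odd (\sum_(p | room p) \sum_(d | typed i0 d) incident d p).
  by [].
elim/big_ind: _ => // [m n|p rp].
  by rewrite oddD; case: (odd m); case: (odd n).
by rewrite -cardE even_typed_door //; have := H p; rewrite rp => /= ->.
Qed.

End Scarf.

Local Open Scope classical_set_scope.
Local Open Scope ring_scope.

(** * Two lines meeting all pairs *)

Section TwoIntervals.
Variables (R : realFieldType) (I : finType).
Implicit Types (S : {set I}) (l h : I -> R).

Definition overlap l h i j := [&& l i <= h i, l j <= h j, l i <= h j & l j <= h i].

(* The point [a] is the leftmost right end of a pair of intervals [l, h] whose
   companions [l', h'] are disjoint: two such pairs on the two sides of [a]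
   would form a 4-cycle in the intersection graph of the intervals [l', h']. *)
Lemma two_intervals S l h l' h' :
    {in S &, forall i j, i != j -> overlap l h i j || overlap l' h' i j} ->
  exists a, {in S &, forall i j, i != j -> ~~ (l i <= a <= h i) ->
    ~~ (l j <= a <= h j) -> overlap l' h' i j}.
Proof.
move=> ovS; pose bad p := [&& p.1 \in S, p.2 \in S, p.1 != p.2 &
  ~~ overlap l' h' p.1 p.2].
case: (pickP bad) => [p0 bad0|nobad]; last first.
  exists 0 => i j iS jS ij _ _; have := nobad (i, j).
  by rewrite /bad /= iS jS ij /=; case: overlap.
case: (Order.TotalTheory.arg_minP (fun p => Num.max (h p.1) (h p.2)) bad0).
case=> i0 j0 /and4P[/= i0S j0S ij0 nov0] pmin; set a := Num.max _ _ in pmin.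
have hi0 : h i0 <= a by rewrite /a le_max lexx.
have hj0 : h j0 <= a by rewrite /a le_max lexx orbT.
move: pmin hi0 hj0; move: a => a pmin hi0 hj0.
exists a => i j iS jS ij ai aj; apply/negPn/negP => nov.
have := ovS i j iS jS ij; rewrite (negPf nov) orbF => /and4P[lhi lhj lihj ljhi].
have := pmin (i, j); rewrite /bad /= iS jS ij nov /= => /(_ isT) ah.
have [ai' aj'] : a < l i /\ a < l j.
  have {}ah : a <= h i \/ a <= h j by move: ah; rewrite le_max => /orP.
  move: ai aj; rewrite !negb_and -!ltNge => /orP ai /orP aj.
  by case: ah ai aj => ? [] ? [] ?; split; lra.
have apart k m : k \in S -> m \in S -> l m <= h m -> h k <= a -> a < l m ->
    overlap l' h' k m.
  move=> kS mS lhm hk am; have km : k != m by apply/eqP => km; rewrite km in hk; lra.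
  have := ovS k m kS mS km; case/orP => // /and4P[_ _ _ ?]; lra.
have /and4P[? ? ? ?] := apart i0 i i0S iS lhi hi0 ai'.
have /and4P[? ? ? ?] := apart j0 i j0S iS lhi hj0 ai'.
have /and4P[? ? ? ?] := apart i0 j i0S jS lhj hi0 aj'.
have /and4P[? ? ? ?] := apart j0 j j0S jS lhj hj0 aj'.
move: nov0 nov; rewrite /overlap !negb_and -!ltNge => /or4P nov0 /or4P nov.
by case: nov0 => ?; case: nov => ?; lra.
Qed.

(** Reversed ends for the empty list encode the empty interval, which then overlaps nothing. *)
Lemma seq_hull (s : seq R) : exists m n, [/\ {in s, forall x, m <= x <= n},
  s != [::] -> m \in s /\ n \in s & s = [::] -> n < m].
Proof.
elim: s => [|x s [m [n [mn ne _]]]].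
  by exists 1, 0; split=> // _; rewrite ltr01.
have [->|/ne[ms ns]] := eqVneq s [::].
  by exists x, x; split=> // [y|_]; rewrite !inE // => /eqP ->; rewrite lexx.
exists (Num.min x m), (Num.max x n); split=> // [y|_].
  rewrite inE ge_min le_max => /predU1P[->|/mn/andP[-> ->]]; last by rewrite !orbT.
  by rewrite !lexx.
by rewrite /Num.min /Num.max !inE; split; case: ifP => _; rewrite ?eqxx ?ms ?ns ?orbT.
Qed.

End TwoIntervals.

(** * Affine forms, convex sets and faces in the plane *)

Section Plane.
Variable R : realType.
Local Notation V := 'rV[R]_2.
Implicit Types (p q y z : V) (X : set V) (f g : R * R * R).

Definition cvx X := forall p q t, X p -> X q -> 0 <= t -> t <= 1 ->
  X ((1 - t) *: p + t *: q).

(* The triple (a, b, c) stands for the affine form a x + b y + c. *)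
Definition aff f p := f.1.1 * p 0 0 + f.1.2 * p 0 1 + f.2.

Definition lin u f v g : R * R * R :=
  (u * f.1.1 + v * g.1.1, u * f.1.2 + v * g.1.2, u * f.2 + v * g.2).

Definition opf f := lin (-1) f 0 f.

(** A coordinate along the line f = 0; only differences and order of its values matter, hence the
    zero constant term. *)
Definition rot f : R * R * R := (- f.1.2, f.1.1, 0).

Definition det f g := f.1.1 * g.1.2 - f.1.2 * g.1.1.

Lemma aff_seg f p q t :
  aff f ((1 - t) *: p + t *: q) = (1 - t) * aff f p + t * aff f q.
Proof. by rewrite /aff !mxE; ring. Qed.

Lemma aff_lin u f v g p : aff (lin u f v g) p = u * aff f p + v * aff g p.
Proof. by rewrite /aff /=; ring. Qed.

Lemma aff_opf f p : aff (opf f) p = - aff f p.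
Proof. by rewrite aff_lin; ring. Qed.

Lemma row2P p q : p 0 0 = q 0 0 -> p 0 1 = q 0 1 -> p = q.
Proof.
move=> e0 e1; apply/rowP => -[[|[|//]] i2].
  by rewrite (_ : Ordinal i2 = 0) //; apply/val_inj.
by rewrite (_ : Ordinal i2 = 1) //; apply/val_inj.
Qed.

Lemma aff_det_inj f g p q : det f g != 0 -> aff f p = aff f q ->
  aff g p = aff g q -> p = q.
Proof.
rewrite /aff /det => fg ef eg.
apply: row2P; apply/eqP; rewrite -subr_eq0.
  rewrite -(mulrI_eq0 _ (lregP fg)); apply/eqP.
  transitivity ((f.1.1 * p 0 0 + f.1.2 * p 0 1 + f.2 - (f.1.1 * q 0 0 + f.1.2 * q 0 1
    + f.2)) * g.1.2
   - (g.1.1 * p 0 0 + g.1.2 * p 0 1 + g.2 - (g.1.1 * q 0 0 + g.1.2 * q 0 1 + g.2)) *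
     f.1.2); first by ring.
  by rewrite ef eg; ring.
rewrite -(mulrI_eq0 _ (lregP fg)); apply/eqP.
transitivity ((g.1.1 * p 0 0 + g.1.2 * p 0 1 + g.2 - (g.1.1 * q 0 0 + g.1.2 * q 0 1 +
  g.2)) * f.1.1
   - (f.1.1 * p 0 0 + f.1.2 * p 0 1 + f.2 - (f.1.1 * q 0 0 + f.1.2 * q 0 1 + f.2)) *
     g.1.1); first by ring.
by rewrite ef eg; ring.
Qed.

Lemma det_rot f : (f.1.1 != 0) || (f.1.2 != 0) -> det f (rot f) != 0.
Proof.
rewrite /det /=; case/orP => f0; rewrite mulrN opprK -!expr2 gt_eqF //.
  by rewrite ltr_pwDl ?sqr_ge0 // exprn_even_gt0.
by rewrite ltr_pwDr ?sqr_ge0 // exprn_even_gt0.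
Qed.

Lemma seg_zero f p q : aff f p * aff f q <= 0 ->
  exists t, [/\ 0 <= t, t <= 1 & aff f ((1 - t) *: p + t *: q) = 0].
Proof.
move=> fpq; have [fp0|fp] := eqVneq (aff f p) 0.
  by exists 0; rewrite aff_seg fp0; split=> //; lra.
have d0 : aff f p - aff f q != 0.
  apply: contraTneq fpq => /subr0_eq <-; rewrite -ltNge -expr2.
  by rewrite exprn_even_gt0.
have dd : 0 < (aff f p - aff f q) ^+ 2 by rewrite exprn_even_gt0.
have fpp : 0 < aff f p ^+ 2 by rewrite exprn_even_gt0.
exists (aff f p / (aff f p - aff f q)); split.
(* Over a squared denominator no case distinction on the sign of [aff f p - aff f q] is needed. *)
- have -> : aff f p / (aff f p - aff f q) =
    (aff f p * (aff f p - aff f q)) / (aff f p - aff f q) ^+ 2 by field.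
  by apply: divr_ge0; nra.
- have -> : aff f p / (aff f p - aff f q) =
    (aff f p * (aff f p - aff f q)) / (aff f p - aff f q) ^+ 2 by field.
  by rewrite ler_pdivrMr // mul1r; nra.
- by rewrite aff_seg; field.
Qed.

Lemma cvx_zero X f p q : cvx X -> X p -> X q -> aff f p * aff f q <= 0 ->
  exists t, [/\ 0 <= t, t <= 1, X ((1 - t) *: p + t *: q)
                & aff f ((1 - t) *: p + t *: q) = 0].
Proof. by move=> cX Xp Xq /seg_zero[t [t0 t1 ft]]; exists t; split=> //; apply: cX. Qed.

Lemma cvxI X Y : cvx X -> cvx Y -> cvx (X `&` Y).
Proof. by move=> cX cY p q t [? ?] [? ?] ? ?; split; [apply: cX|apply: cY]. Qed.

Section Family.
Variables (I : finType) (A : I -> set V).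
Hypotheses (A_cvx : forall i, cvx (A i)) (A_ne : forall i, A i !=set0).
Implicit Types (S : {set I}).

Definition face S := exists y, forall i, i \in S -> A i y.

Definition two_faces S := exists S1 S2, [/\ face S1, face S2 & S \subset S1 :|: S2].

Lemma face0 : face finset.set0.
Proof. by exists 0 => i; rewrite inE. Qed.

Lemma face_line f S : (f.1.1 != 0) || (f.1.2 != 0) ->
  (exists l h : I -> R, {in S &, forall i j, l i <= h j} /\
    forall i x, i \in S -> l i <= x <= h i ->
      exists2 y, A i y /\ aff f y = 0 & aff (rot f) y = x) -> face S.
Proof.
move=> f0 [l [h [lh Alh]]]; have [->|[i0 i0S]] := set_0Vmem S; first exact: face0.
case: (Order.TotalTheory.arg_maxP l i0S) => i iS imax.
have H j : j \in S -> exists2 y, A j y /\ aff f y = 0 & aff (rot f) y = l i.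
  by move=> jS; apply: Alh; rewrite ?lh ?andbT //; apply: imax.
have [y [Ay fy] ry] := H i iS; exists y => j jS.
have [z [Az fz] rz] := H j jS.
by have -> : y = z; first by apply: (aff_det_inj (det_rot f0)); rewrite ?fy ?ry.
Qed.

Lemma small_faces S : (#|S| <= 1)%N -> face S.
Proof.
move=> S1; have [->|[i iS]] := set_0Vmem S; first exact: face0.
have [y Ay] := A_ne i; exists y => j jS.
by rewrite (card_le1_eqP S1 i j).
Qed.

Lemma two_faces_gt2 S : ~ two_faces S -> (2 < #|S|)%N.
Proof.
move=> nS; rewrite ltnNge; apply/negP => S2; apply: nS.
have [->|[i iS]] := set_0Vmem S.
  by exists finset.set0, finset.set0; split; rewrite ?finset.sub0set //; exact: face0.
exists [set i]%SET, (S :\ i)%SET; split; last by rewrite finset.setD1K.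
  by apply: small_faces => //; rewrite cards1.
by apply: small_faces => //; move: S2; rewrite (cardsD1 i) iS.
Qed.

Lemma two_faces_sub S S' : S \subset S' -> two_faces S' -> two_faces S.
Proof.
move=> SS' [S1 [S2 [f1 f2 S12]]]; exists S1, S2; split=> //.
exact: fintype.subset_trans S12.
Qed.

(** One common point is chosen for each pair, and each set is replaced on either line by the
    interval spanned by its chosen points; these intervals have attained ends although the sets need
    not be closed. The point a of [two_intervals] on f = 0 gives one face, and the sets whose
    interval avoids a meet pairwise on g = 0, where Helly on a line gives the other. *)
Theorem two_lines f g S :
    (f.1.1 != 0) || (f.1.2 != 0) -> (g.1.1 != 0) || (g.1.2 != 0) ->
    {in S &, forall i j, i != j ->
       exists2 y, A i y /\ A j y & aff f y = 0 \/ aff g y = 0} ->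
  two_faces S.
Proof.
move=> f0 g0 meet.
have [w wP] : exists w : I -> I -> V, forall i j, i \in S -> j \in S -> i != j ->
    (A i (w i j) /\ A j (w i j)) /\ (aff f (w i j) = 0 \/ aff g (w i j) = 0).
  have [e|w wP] := @choice _ _ (fun (e : I * I) y => e.1 \in S -> e.2 \in S ->
    e.1 != e.2 -> (A e.1 y /\ A e.2 y) /\ (aff f y = 0 \/ aff g y = 0)).
    have [iS|] := boolP (e.1 \in S); last by exists 0.
    have [jS|] := boolP (e.2 \in S); last by exists 0.
    have [_|ij] := eqVneq e.1 e.2; first by exists 0.
    by have [y ? ?] := meet e.1 e.2 iS jS ij; exists y.
  by exists (fun i j => w (i, j)) => i j; apply: (wP (i, j)).
pose W := [seq w p.1 p.2 | p : I * I].
pose X k i := [seq aff (rot k) y | y <- W & `[< A i y >] && (aff k y == 0)].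
have hullX k i : exists mn : R * R,
    (forall y, y \in W -> A i y -> aff k y = 0 -> mn.1 <= aff (rot k) y <= mn.2) /\
    forall x, mn.1 <= x <= mn.2 -> exists2 y, A i y /\ aff k y = 0 & aff (rot k) y = x.
  have [m [n [Xmn mnX0 nm]]] := seq_hull (X k i); exists (m, n); split=> /=.
    move=> y yW Aiy ky; apply: Xmn; apply: map_f.
    by rewrite mem_filter ky eqxx yW; apply/andP; split=> //; apply/andP; split=> //;
      apply/asboolP.
  move=> x /andP[mx xn]; have X0 : X k i != [::].
    by apply: contraTneq mx => /nm; move: xn; rewrite -ltNge; apply: le_lt_trans.
  have [/mapP[p pW mE] /mapP[q qW nE]] := mnX0 X0.
  move: pW qW; rewrite !mem_filter => /andP[/andP[/asboolP Ap /eqP kp] _].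
  move=> /andP[/andP[/asboolP Aq /eqP kq] _].
  have cX : cvx (A i `&` [set y | aff k y = 0]).
    apply: cvxI => // u v t /= ku kv _ _; rewrite aff_seg ku kv; ring.
  pose kx : R * R * R := ((rot k).1.1, (rot k).1.2, - x).
  have kxE y : aff kx y = aff (rot k) y - x by rewrite /aff /=; ring.
  have [|||t [_ _ [At kt] xt]] := @cvx_zero _ kx p q cX.
  - by split.
  - by split.
  - by rewrite !kxE -mE -nE; nra.
  by exists ((1 - t) *: p + t *: q) => //; move: xt; rewrite kxE => /subr0_eq.
have [mf mfP] := choice (hullX f); have [mg mgP] := choice (hullX g).
have ov i j : i \in S -> j \in S -> i != j ->
    overlap (fun i => (mf i).1) (fun i => (mf i).2) i j
    || overlap (fun i => (mg i).1) (fun i => (mg i).2) i j.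
  move=> iS jS ij; have [[Aiw Ajw] fg] := wP i j iS jS ij.
  have wW : w i j \in W by apply/mapP; exists (i, j); rewrite ?mem_enum.
  apply/orP; case: fg => kw; [left|right].
    have /andP[? ?] := (mfP i).1 _ wW Aiw kw.
    have /andP[? ?] := (mfP j).1 _ wW Ajw kw.
    by apply/and4P; split; lra.
  have /andP[? ?] := (mgP i).1 _ wW Aiw kw.
  have /andP[? ?] := (mgP j).1 _ wW Ajw kw.
  by apply/and4P; split; lra.
have [a aP] := two_intervals ov.
pose S1 := [set i in S | (mf i).1 <= a <= (mf i).2]%SET.
exists S1, (S :\: S1); split; last by rewrite -subDset.
  apply: (face_line f0); exists (fun=> a), (fun=> a); split=> [? ? _ _//|i x].
  rewrite inE => /andP[_ ia] /le_anti <-; exact: (mfP i).2.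
have [/small_faces//|] := leqP #|S :\: S1| 1.
case/card_gt1P => i1 [i2 [i1S i2S i12]].
have ov2 i j : i \in S :\: S1 -> j \in S :\: S1 -> i != j ->
    overlap (fun i => (mg i).1) (fun i => (mg i).2) i j.
  by rewrite !inE => /andP[+ iS] /andP[+ jS]; rewrite iS jS => ai aj ij; apply: aP.
apply: (face_line g0); exists (fun i => (mg i).1), (fun i => (mg i).2).
split=> [i j iS jS|i x _]; last exact: (mgP i).2.
have [<-|ij] := eqVneq i j; last by case/and4P: (ov2 i j iS jS ij).
(* For i = j the interval on g = 0 has to be nonempty: it overlaps that of another of the at least
   two remaining sets. *)
have [ii|ii] := eqVneq i i1; last by case/and4P: (ov2 i i1 iS i1S ii).
by rewrite ii; case/and4P: (ov2 i1 i2 i1S i2S i12).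
Qed.

End Family.
End Plane.

(** * Helly's theorem in the plane *)

Section Helly.
Variable R : realType.
Local Notation V := 'rV[R]_2.
Implicit Types (p q y z : V) (X : set V) (f g : R * R * R).

Lemma cvx_sum X (J : eqType) (s : seq J) (w : J -> R) (p : J -> V) : cvx X ->
    {in s, forall j, 0 < w j /\ X (p j)} -> s != [::] ->
  X ((\sum_(j <- s) w j)^-1 *: \sum_(j <- s) w j *: p j).
Proof.
move=> cX; elim: s => // i s IH wX _; rewrite !big_cons.
have [w0 Xi] := wX i (mem_head _ _).
have {}wX : {in s, forall j, 0 < w j /\ X (p j)}.
  by move=> j js; apply: wX; rewrite inE js orbT.
have [->|s0] := eqVneq s [::].
  by rewrite !big_nil !addr0 scalerA mulVf ?gt_eqF // scale1r.
set W := \sum_(j <- s) w j; set p' := \sum_(j <- s) _.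
have W0 : 0 < W.
  rewrite /W; case: s s0 wX {IH W p'} => // j s _ wX; rewrite big_cons.
  rewrite ltr_pwDl ?(wX j (mem_head _ _)).1 // big_seq sumr_ge0 // => k ks.
  by rewrite ltW // (wX k _).1 // inE ks orbT.
have wW : w i + W != 0 by rewrite gt_eqF // addr_gt0.
have := cX _ _ (W / (w i + W)) Xi (IH wX s0).
rewrite -/W -/p' scalerA scalerDr scalerA => H.
have -> : (w i + W)^-1 * w i = 1 - W / (w i + W) by field.
have E : W / (w i + W) * W^-1 = (w i + W)^-1 by field; rewrite wW gt_eqF.
rewrite E in H; apply: H; rewrite ?ler_pdivrMr ?divr_ge0 ?mul1r ?addr_gt0 ?lerDr ?ltW
  ?addr_gt0 //.
Qed.

Section Family.
Variables (I : finType) (A : I -> set V).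
Hypotheses (A_cvx : forall i, cvx (A i)) (A_ne : forall i, A i !=set0).
Implicit Types (S : {set I}).

Definition good i j k := exists y, [/\ A i y, A j y & A k y].

(** Radon's theorem, with membership in all convex X in place of convex hulls. Four vectors (x, y,
    1) in dimension three satisfy a nontrivial linear relation; the point y is the weighted mean of
    its positive part and equally of its negative part. *)
Lemma radon (p : 'I_4 -> V) : exists (P : pred 'I_4) y,
  forall X, cvx X -> ((forall i, P i -> X (p i)) \/ (forall i, ~~ P i -> X (p i))) -> X y.
Proof.
pose M : 'M[R]_(4, 3) := \matrix_(i, j) [:: p i 0 0; p i 0 1; 1]`_j.
have : kermx M != 0.
  by rewrite -mxrank_eq0 mxrank_ker subn_eq0 -ltnNge (leq_ltn_trans (rank_leq_col M)).
case/rowV0Pn => w /sub_kermxP wM w0.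
have wj j : \sum_i w 0 i * M i j = 0.
  by have /rowP/(_ j) := wM; rewrite !mxE.
have sw : \sum_i w 0 i = 0.
  rewrite -[RHS](wj (inord 2)); apply: eq_bigr => i _.
  by rewrite mxE inordK // mulr1.
have swp : \sum_i w 0 i *: p i = 0.
  apply: row2P; rewrite summxE mxE.
    rewrite -[RHS](wj 0); apply: eq_bigr => i _; by rewrite !mxE.
  rewrite -[RHS](wj (inord 1)); apply: eq_bigr => i _.
  by rewrite !mxE inordK.
pose P : pred 'I_4 := fun i => 0 < w 0 i.
pose N : pred 'I_4 := fun i => w 0 i < 0.
have sPN : \sum_(i | P i) w 0 i = \sum_(i | N i) - w 0 i.
  apply/eqP; rewrite -subr_eq0 -sumrN big_mkcond [X in _ + X]big_mkcond -big_split.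
  rewrite -[X in _ == X]sw; apply/eqP; apply: eq_bigr => i _ /=.
  by rewrite /P /N; case: ltrgt0P => // [||->]; rewrite ?oppr0 ?opprK ?addr0 ?add0r.
have swPN : \sum_(i | P i) w 0 i *: p i = \sum_(i | N i) (- w 0 i) *: p i.
  apply/eqP; rewrite -subr_eq0 -sumrN big_mkcond [X in _ + X]big_mkcond -big_split.
  rewrite -[X in _ == X]swp; apply/eqP; apply: eq_bigr => i _ /=.
  rewrite /P /N; case: ltrgt0P => // [||->]; rewrite ?scale0r ?addr0 //.
  by rewrite scaleNr opprK add0r.
have [i Ni] : exists i, N i.
  case: (pickP N) => [i Ni|N0]; [by exists i|case/eqP: w0].
  move: sPN; rewrite [RHS]big_pred0 => [/eqP|//].
  rewrite psumr_eq0 => [/allP P0|i /ltW//]; apply/rowP => i.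
  rewrite mxE; have := P0 i (mem_index_enum _); have := N0 i.
  by rewrite /N /P; case: ltrgt0P => //= ? _ /eqP.
have [j Pj] : exists i, P i.
  case: (pickP P) => [j Pj|P0]; [by exists j|move: sPN].
  rewrite big_pred0 => [/esym/eqP|//].
  rewrite psumr_eq0 => [/allP /(_ i (mem_index_enum _))|k];
    last by rewrite oppr_ge0 => /ltW.
  by rewrite Ni oppr_eq0 /= => /eqP wi0; move: Ni; rewrite /N wi0 ltxx.
have nonnil (Q : pred 'I_4) k : Q k -> [seq l <- index_enum 'I_4 | Q l] != [::].
  move=> Qk; apply/eqP => Q0; suff : k \in [seq l <- index_enum 'I_4 | Q l] by rewrite Q0.
  by rewrite mem_filter Qk mem_index_enum.
exists P, ((\sum_(i | P i) w 0 i)^-1 *: \sum_(i | P i) w 0 i *: p i) => X cX [] HX.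
  rewrite -!(big_filter (index_enum _) P); apply: cvx_sum => //; last exact: nonnil Pj.
  by move=> k; rewrite mem_filter => /andP[Pk _]; split=> //; apply: HX.
rewrite swPN sPN -!(big_filter (index_enum _) N); apply: cvx_sum => //;
  last exact: nonnil Ni.
move=> k; rewrite mem_filter oppr_gt0 => /andP[Nk _]; split=> //; apply: HX.
by rewrite /P -leNgt ltW.
Qed.

(** Induction through Radon's theorem: [p k] lies in every set but [e k], and since e is injective
    each set contains all the points on one side of the Radon partition. *)
Theorem helly S : (forall i j k, i \in S -> j \in S -> k \in S -> good i j k) ->
  face A S.
Proof.
have [n] := ubnP #|S|; elim: n S => // n IH S Sn goodS.
have [/card_le1_eqP S1|] := leqP #|S| 1.
  apply: small_faces => //; exact/card_le1_eqP.
have [S3|S4] := leqP #|S| 3.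
  move=> S1; have [a [b [c [aS bS cS Sabc]]]] : exists a b c, [/\ a \in S, b \in S,
    c \in S &
      forall i, i \in S -> [|| i == a, i == b | i == c]].
    case/card_gt1P: S1 => a [b [aS bS ab]].
    have [/fintype.subsetP Sab|/fintype.subsetPn[c cS]] := boolP (S \subset [set a;
      b]%SET).
      exists a, b, b; split=> // i /Sab; rewrite !inE => /orP[]->; rewrite ?orbT //.
    rewrite !inE negb_or => /andP[ca cb]; exists a, b, c; split=> // i iS.
    apply: contraLR S3; rewrite !negb_or -ltnNge => /and3P[ia ib ic].
    have u : uniq [:: i; a; b; c] by rewrite /= !inE !negb_or ia ib ic ab eq_sym ca
      eq_sym cb.
    rewrite -[X in (X <= _)%N]/(size [:: i; a; b; c]) -(card_uniqP u).
    apply: subset_leq_card; apply/fintype.subsetP => k.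
    by rewrite !inE => /or4P[]/eqP->.
  have [y [ya yb yc]] := goodS a b c aS bS cS; exists y => i /Sabc.
  by case/or3P => /eqP ->.
move=> _; pose e : 'I_4 -> I := fun k => nth (enum_val (Ordinal S4)) (enum S) k.
have eS k : e k \in S.
  by rewrite -mem_enum mem_nth // -cardE; exact: leq_trans (ltn_ord k) S4.
have e_inj : injective e.
  move=> k l /eqP; rewrite nth_uniq ?enum_uniq -?cardE ?(leq_trans (ltn_ord _) S4) //.
  by move/eqP/val_inj.
have [p pP] : exists p : 'I_4 -> V, forall k i, i \in S -> i != e k -> A i (p k).
  have [k|p pP] := @choice _ _ (fun k y => forall i, i \in S -> i != e k -> A i y).
    have [|i j l|y yP] := IH (S :\ e k).
    - by move: Sn; rewrite (cardsD1 (e k) S) eS.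
    - by rewrite !inE => /andP[_ +] /andP[_ +] /andP[_ +]; apply: goodS.
    by exists y => i iS ik; apply: yP; rewrite !inE ik.
  by exists p.
have [P [y Hy]] := radon p; exists y => i iS; apply: Hy => //.
have [/existsP[k /andP[Pk /eqP ik]]|/existsPn H] :=
  boolP [exists k, P k && (e k == i)]; [right|left] => l Pl; apply: pP => //.
  by rewrite -ik; apply: contraNneq Pl => /e_inj <-.
by have := H l; rewrite Pl /= eq_sym.
Qed.

End Family.
End Helly.

(** * Sets missing the quadrants of a cross *)

Section Quadrants.
Variable R : realType.
Local Notation V := 'rV[R]_2.
Implicit Types (p q y z : V) (X : set V) (f g : R * R * R).

(** The product says that m separates X from Y without telling which one is on the left; m is the
    supremum of the left one, and arbitrary when one is empty. *)
Lemma interval_gap (X Y : set R) :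
    (forall x1 x2 x, X x1 -> X x2 -> x1 <= x <= x2 -> X x) ->
    (forall y1 y2 y : R, Y y1 -> Y y2 -> y1 <= y <= y2 -> Y y) ->
    (forall x, X x -> Y x -> False) ->
  exists m, forall x y : R, X x -> Y y -> (x - m) * (y - m) <= 0.
Proof.
have H (X' Y' : set R) (x0 y0 : R) :
    (forall x1 x2 x, X' x1 -> X' x2 -> x1 <= x <= x2 -> X' x) ->
    (forall y1 y2 y : R, Y' y1 -> Y' y2 -> y1 <= y <= y2 -> Y' y) ->
    (forall x, X' x -> Y' x -> False) -> X' x0 -> Y' y0 -> x0 < y0 ->
    exists m, forall x y : R, X' x -> Y' y -> x <= m <= y.
  move=> iX iY XY Xx0 Yy0 xy0.
  have lt (x y : R) : X' x -> Y' y -> x < y.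
    move=> Xx Yy; rewrite ltNge; apply/negP => yx; have [yx0|xy] := leP y x0.
      by apply: (XY x0 Xx0); apply: (iY y y0) => //; rewrite yx0 ltW.
    by apply: (XY y) => //; apply: (iX x0 x) => //; rewrite yx ltW.
  exists (sup X') => x y Xx Yy; apply/andP; split.
    by apply: ub_le_sup => //; exists y0 => u Xu; rewrite ltW // lt.
  by apply: ge_sup; [exists x0|move=> u Xu; rewrite ltW // lt].
move=> iX iY XY; have [[x0 Xx0]|X0] := pselect (X !=set0); last first.
  by exists 0 => x y Xx; case: X0; exists x.
have [[y0 Yy0]|Y0] := pselect (Y !=set0); last first.
  by exists 0 => x y _ Yy; case: Y0; exists y.
case: (ltgtP x0 y0) => [xy|yx|xy].
- have [m mP] := H X Y x0 y0 iX iY XY Xx0 Yy0 xy.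
  by exists m => x y Xx Yy; have /andP[? ?] := mP x y Xx Yy; nra.
- have [m mP] := H Y X y0 x0 iY iX (fun x Yx Xx => XY x Xx Yx) Yy0 Xx0 yx.
  by exists m => x y Xx Yy; have /andP[? ?] := mP y x Yy Xx; nra.
- by case: (XY x0) => //; rewrite xy.
Qed.

Section Family.
Variables (I : finType) (A : I -> set V).
Hypotheses (A_cvx : forall i, cvx (A i)) (A_ne : forall i, A i !=set0).
Hypothesis A43 : forall i j k l, uniq [:: i; j; k; l] ->
  [\/ good A i j k, good A i j l, good A i k l | good A j k l].
Implicit Types (S : {set I}).

(** The quadrant is closed here, given by f <= 0 and g <= 0; its disjointness from the set is
    phrased through strict signs. *)
Definition missing f g : {set I} :=
  [set i | `[< forall y, A i y -> 0 < aff f y \/ 0 < aff g y >]]%SET.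

Lemma missingP f g i y : i \in missing f g -> A i y -> aff f y <= 0 -> 0 < aff g y.
Proof. by rewrite inE => /asboolP/[apply]-[]// ?; lra. Qed.

Lemma missingC f g : missing f g = missing g f.
Proof.
by apply/setP => i; rewrite !inE; apply/asboolP/asboolP => H y /H[]; tauto.
Qed.

(** C and D together exclude a closed quadrant and its opposite, so their intersection lies in the
    two other open quadrants; being convex, it stays in the one that contains z. *)
Lemma opposite f g C D z y : C \in missing f g -> D \in missing (opf f) (opf g) ->
  A C z -> A D z -> aff f z < 0 -> A C y -> A D y -> aff f y < 0 /\ 0 < aff g y.
Proof.
move=> CM DM Cz Dz fz Cy Dy.
have neg u : A C u -> A D u -> aff f u < 0 \/ 0 < aff f u.
  move=> Cu Du; have := missingP CM Cu; have := missingP DM Du.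
  rewrite !aff_opf; case: (ltrgt0P (aff f u)) => [||->]; [by right|by left|].
  by rewrite oppr0 lexx => /(_ isT) ? /(_ isT) ?; lra.
have fy : aff f y < 0.
  case: (neg y Cy Dy) => // fy.
  have [|t [t0 t1 [Ct Dt] ft]] := cvx_zero (f :=
    f) (cvxI (@A_cvx C) (@A_cvx D)) (conj Cz Dz) (conj Cy Dy).
    by nra.
  by case: (neg _ Ct Dt); lra.
by split=> //; apply: (missingP CM Cy); exact: ltW.
Qed.

Lemma det_ne f g : det f g != 0 -> (f.1.1 != 0) || (f.1.2 != 0).
Proof.
by rewrite /det; have [->|//] := eqVneq f.1.1 0; have [->|//] := eqVneq f.1.2 0;
  rewrite !mul0r subrr eqxx.
Qed.

(* By (4,3), any two members Z and Z' of the third quadrant class have a common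
   point on two of C, C', D, and Z meets Z' on the segment joining these two
   points. This segment crosses g' = 0, the line through z and the vertex of the
   cross, or d = 0, the line through z and a point of f = 0 between C and C'. *)
Lemma fan f g C C' D z : det f g != 0 -> uniq [:: C; C'; D] ->
    C \in missing f g -> C' \in missing f g -> D \in missing (opf f) (opf g) ->
    A C z -> A C' z -> A D z -> aff f z < 0 ->
    (forall y, A C y -> A C' y -> aff f y != 0 /\ aff g y != 0) ->
  two_faces A (missing f (opf g)).
Proof.
move=> fg u3 CM C'M DM Cz C'z Dz fz off.
have [CC' CD C'D] : [/\ C != C', C != D & C' != D].
  by move: u3; rewrite /= !inE !negb_or andbT => /andP[/andP[]].
have gz : 0 < aff g z by apply: (missingP CM Cz); exact: ltW.
pose g' := lin (aff g z) f (- aff f z) g.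
pose X E := [set x | exists y, [/\ A E y, aff f y = 0 & aff (rot f) y = x]].
have iX E x1 x2 x : X E x1 -> X E x2 -> x1 <= x <= x2 -> X E x.
  move=> [p [Ep fp pE]] [q [Eq fq qE]] /andP[x1x xx2].
  have cX : cvx (A E `&` [set y | aff f y = 0]).
    by apply: cvxI => // u v t /= fu fv _ _; rewrite aff_seg fu fv; ring.
  have kxE y : aff ((rot f).1.1, (rot f).1.2, - x) y = aff (rot f) y - x.
    by rewrite /aff /=; ring.
  have [|t [_ _ [Et ft] xt]] := cvx_zero (f := ((rot f).1.1, (rot f).1.2,
    - x)) cX (conj Ep fp) (conj Eq fq).
    by rewrite !kxE pE qE; nra.
  by exists ((1 - t) *: p + t *: q); split=> //; move: xt; rewrite kxE => /subr0_eq.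
have XX x : X C x -> X C' x -> False.
  move=> [y [Cy fy <-]] [y' [C'y fy' /(aff_det_inj (det_rot (det_ne fg)))]].
  rewrite fy fy' => /(_ erefl) yy'; rewrite yy' in C'y.
  by have [] := off y Cy C'y; rewrite fy eqxx.
have [m mP] := interval_gap (iX C) (iX C') XX.
pose k : R * R * R := ((rot f).1.1, (rot f).1.2, - m).
have kE y : aff k y = aff (rot f) y - m by rewrite /aff /=; ring.
pose d := lin (aff k z) f (- aff f z) k.
have missZ Z E y : Z \in missing f (opf g) -> E \in missing f g ->
    A Z y -> A E y -> 0 < aff f y.
  move=> ZM EM Zy Ey; rewrite ltNge; apply/negP => fy.
  have := missingP ZM Zy fy; have := missingP EM Ey fy; rewrite aff_opf; lra.
have missD Z y : Z \in missing f (opf g) -> A Z y -> A D y -> aff g y < 0.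
  move=> ZM Zy Dy; rewrite ltNge; apply/negP => gy.
  have fy : 0 < aff (opf f) y by apply: (missingP _ Dy); [rewrite missingC;
    exact: DM|rewrite aff_opf; lra].
  by have := missingP ZM Zy; rewrite !aff_opf in fy *; lra.
have cross E y : E \in missing f g -> A E z -> A E y -> 0 < aff f y ->
    exists v t, [/\ 0 < t, A E v, aff f v = 0, v = (1 - t) *: z + t *: y & 0 < aff g v].
  move=> EM Ez Ey fy; have [|t [t0 t1 Ev fv]] := cvx_zero (f := f) (@A_cvx E) Ez Ey.
    by nra.
  exists ((1 - t) *: z + t *: y), t; split=> //.
    rewrite lt_neqAle t0 andbT; apply/eqP => t00; move: fv.
    by rewrite -t00 aff_seg; lra.
  by apply: (missingP EM Ev); rewrite fv.
have g'C E Z y : E \in missing f g -> Z \in missing f (opf g) -> A E z -> A E y ->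
  A Z y -> 0 < aff g' y.
  move=> EM ZM Ez Ey Zy; have [v [t [t0 Ev fv vE gv]]] :=
    cross E y EM Ez Ey (missZ Z E y ZM EM Zy Ey).
  have : aff g' v = t * aff g' y.
    by rewrite vE aff_seg (_ : aff g' z = 0) ?mulr0 ?add0r // aff_lin; ring.
  by rewrite aff_lin fv => ?; nra.
have g'D Z y : Z \in missing f (opf g) -> A Z y -> A D y -> aff g' y < 0.
  move=> ZM Zy Dy; have gy := missD Z y ZM Zy Dy.
  have [|t [t0 t1 Dv gv]] := cvx_zero (f := g) (@A_cvx D) Dz Dy; first by nra.
  set v := _ + _ in Dv gv.
  have tn : t != 0.
    by apply/eqP => t00; move: gv; rewrite /v t00 aff_seg; lra.
  have tp : 0 < t by rewrite lt_neqAle eq_sym tn.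
  have fv : aff f v < 0.
    have : 0 < aff (opf f) v by apply: (missingP _ Dv); [rewrite missingC;
      exact: DM|rewrite aff_opf gv oppr0].
    by rewrite aff_opf oppr_gt0.
  have : aff g' v = t * aff g' y.
    by rewrite /v aff_seg (_ : aff g' z = 0) ?mulr0 ?add0r // aff_lin; ring.
  by rewrite aff_lin gv => ?; nra.
have hit Z Z' E E' : Z \in missing f (opf g) -> Z' \in missing f (opf g) -> 
   uniq [:: Z; Z'; E; E'] -> (forall y W, W \in missing f (opf g) -> A W y ->
     A E y -> A E' y -> False) ->
   good A Z Z' E \/ good A Z Z' E'.
  move=> ZM Z'M /A43 + bad; case; [by left|by right| |];
    by case=> y [Wy Ey E'y]; case: (bad y _ _ Wy Ey E'y).
have notz Z E : Z \in missing f (opf g) -> A E z -> Z != E.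
  move=> ZM Ez; apply/eqP => ZE; rewrite -ZE in Ez.
  by have := missingP ZM Ez (ltW fz); rewrite aff_opf; lra.
have badD E y W : E \in missing f g -> A E z -> W \in missing f (opf g) -> A W y ->
  A E y -> A D y -> False.
  move=> EM Ez WM Wy Ey Dy; have [fy gy] := opposite EM DM Ez Dz fz Ey Dy.
  by have := missingP WM Wy (ltW fy); rewrite aff_opf; lra.
have badC y W : W \in missing f (opf g) -> A W y -> A C y -> A C' y -> False.
  move=> WM Wy Cy C'y; have fy := missZ _ _ _ WM CM Wy Cy.
  have [|t [t0 t1 [Ct C't] ft]] := cvx_zero (f :=
    f) (cvxI (@A_cvx C) (@A_cvx C')) (conj Cz C'z) (conj Cy C'y).
    by nra.
  by have [] := off _ Ct C't; rewrite ft eqxx.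
apply: (@two_lines _ _ A A_cvx A_ne g' d).
- apply: (@det_ne _ f); rewrite /det /= (_ : _ - _ = aff f z * det f g); last first.
    by rewrite /det; ring.
  by rewrite mulf_neq0 // lt_eqF.
- apply: (@det_ne _ f); rewrite /det /= (_ : _ - _ = aff f z * det f (rot f)); last first.
    by rewrite /det /=; ring.
  by rewrite mulf_neq0 ?det_rot ?(det_ne fg) // lt_eqF.
move=> Z Z' ZM Z'M ZZ'.
have on_g' E y y' : E \in missing f g -> A E z -> [/\ A Z y, A Z' y & A E y] ->
  [/\ A Z y', A Z' y' & A D y'] ->
   exists2 y0, A Z y0 /\ A Z' y0 & aff g' y0 = 0 \/ aff d y0 = 0.
  move=> EM Ez [Zy Z'y Ey] [Zy' Z'y' Dy'].
  have [|t [_ _ [Zt Z't] gt0]] := cvx_zero (f :=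
    g') (cvxI (@A_cvx Z) (@A_cvx Z')) (conj Zy Z'y) (conj Zy' Z'y').
    by have := g'C _ _ _ EM ZM Ez Ey Zy; have := g'D _ _ ZM Zy' Dy'; nra.
  by exists ((1 - t) *: y + t *: y'); [|left].
have uq E E' : A E z -> A E' z -> E != E' -> uniq [:: Z; Z'; E; E'].
  by move=> Ez E'z EE'; rewrite /= !inE !negb_or ZZ' EE' !notz.
have on_d y y' : [/\ A Z y, A Z' y & A C y] -> [/\ A Z y', A Z' y' & A C' y'] ->
   exists2 y0, A Z y0 /\ A Z' y0 & aff g' y0 = 0 \/ aff d y0 = 0.
  move=> [Zy Z'y Cy] [Zy' Z'y' C'y'].
  have [v [t [t0 Cv fv vE _]]] := cross C y CM Cz Cy (missZ _ _ _ ZM CM Zy Cy).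
  have [v' [t' [t'0 C'v fv' vE' _]]] :=
    cross C' y' C'M C'z C'y' (missZ _ _ _ ZM C'M Zy' C'y').
  have dz : aff d z = 0 by rewrite aff_lin; ring.
  have dv : - aff f z * (aff (rot f) v - m) = t * aff d y.
    have : aff d v = t * aff d y by rewrite vE aff_seg dz mulr0 add0r.
    by rewrite aff_lin fv mulr0 add0r kE.
  have dv' : - aff f z * (aff (rot f) v' - m) = t' * aff d y'.
    have : aff d v' = t' * aff d y' by rewrite vE' aff_seg dz mulr0 add0r.
    by rewrite aff_lin fv' mulr0 add0r kE.
  (* The points v of C and v' of C' on f = 0 are separated by m, so y and y' are on different sides
     of d. *)
  have vv' : (aff (rot f) v - m) * (aff (rot f) v' - m) <= 0.
    by apply: mP; [exists v|exists v'].
  have [|s [_ _ [Zs Z's] ds]] := cvx_zero (f :=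
    d) (cvxI (@A_cvx Z) (@A_cvx Z')) (conj Zy Z'y) (conj Zy' Z'y').
    have : (t * aff d y) * (t' * aff d y') <= 0.
      rewrite -dv -dv' mulrACA -expr2 sqrrN; apply: mulr_ge0_le0 => //.
      exact: sqr_ge0.
    by rewrite mulrACA pmulr_rle0 // mulr_gt0.
  by exists ((1 - s) *: y + s *: y'); [|right].
have [[y CCy]|[y C'Cy]] := hit Z Z' C C' ZM Z'M (uq _ _ Cz C'z CC') badC.
  have [[y' C'y']|[y' Dy']] := hit Z Z' C' D ZM Z'M (uq _ _ C'z Dz C'D) (fun y W =>
    badD C' y W C'M C'z).
    exact: on_d CCy C'y'.
  exact: on_g' CM Cz CCy Dy'.
have [[y' C'y']|[y' Dy']] := hit Z Z' C D ZM Z'M (uq _ _ Cz Dz CD) (fun y W => badD C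
  y W CM Cz).
  exact: on_d C'y' C'Cy.
exact: on_g' C'M C'z C'Cy Dy'.
Qed.

Lemma opfK f : opf (opf f) = f.
Proof. by case: f => -[a b] c; rewrite /opf /lin /=; congr (_, _, _); ring. Qed.

Lemma not_on_lines f g : det f g != 0 -> ~ two_faces A (missing f g) ->
  exists C C', [/\ C \in missing f g, C' \in missing f g, C != C' &
    forall y, A C y -> A C' y -> aff f y != 0 /\ aff g y != 0].
Proof.
move=> fg; apply: contra_notP => H.
have gf : det g f != 0 by move: fg; rewrite /det -oppr_eq0 opprB mulrC [f.1.1 * _]mulrC.
apply: (two_lines A_cvx A_ne (det_ne fg) (det_ne gf)) => C C' CM C'M CC'.
apply: contra_notP H => no; exists C, C'; split=> // y Cy C'y; split.
  by apply: contra_notN no => /eqP fy; exists y => //; left.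
by apply: contra_notN no => /eqP gy; exists y => //; right.
Qed.

(** Such a C lies inside one of the two other open quadrants. The sets missing that quadrant are
    disjoint from C, so the (4,3)-property with C as fourth member makes any three of them meet, and
    Helly's theorem gives a single face. *)
Lemma missing_inter f g C : C \in missing f g -> C \in missing (opf f) (opf g) ->
  two_faces A (missing f (opf g)) \/ two_faces A (missing (opf f) g).
Proof.
have H f' g' y : C \in missing f' g' -> C \in missing (opf f') (opf g') ->
    A C y -> aff f' y < 0 -> two_faces A (missing f' (opf g')).
  move=> CM CM' Cy fy; set S := missing _ _.
  have away Z u : Z \in S -> A Z u -> A C u -> False.
    move=> ZM Zu Cu; have [fu gu] := opposite CM CM' Cy Cy fy Cu Cu.
    by have := missingP ZM Zu (ltW fu); rewrite aff_opf; lra.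
  have CS i : i \in S -> i != C.
    by move=> iS; apply/eqP => iC; apply: (away C y) => //; rewrite -iC.
  have good3 i j k : i \in S -> j \in S -> k \in S -> uniq [:: i; j; k] -> good A i j k.
    move=> iS jS kS; rewrite /= !inE negb_or andbT => /andP[/andP[ij ik] jk].
    have /A43[//|||] : uniq [:: i; j; k; C].
      by rewrite /= !inE !negb_or ij ik jk !CS.
    - by case=> u [iu _ Cu]; case: (away i u).
    - by case=> u [iu _ Cu]; case: (away i u).
    - by case=> u [ju _ Cu]; case: (away j u).
  have [//|nS] := pselect (two_faces A S); have S3 := two_faces_gt2 A_ne nS.
  have third i j : exists2 k, k \in S & (k != i) && (k != j).
    have : (0 < #|S :\: [set i; j]|)%N.
      rewrite -(ltn_add2l #|S :&: [set i; j]|) cardsID addn0 (leq_ltn_trans _ S3) //.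
      apply: leq_trans (subset_leq_card (finset.subsetIr _ _)) _.
      by rewrite cards2; case: (i != j).
    by case/card_gt0P => k; rewrite finset.in_setD in_set2 negb_or => /andP[? ?];
      exists k.
  have pair i j : i \in S -> j \in S -> exists2 u, A i u & A j u.
    move=> iS jS; have [<-|ij] := eqVneq i j; first by have [u iu] := A_ne i; exists u.
    have [k kS /andP[ki kj]] := third i j.
    have [|u [iu ju _]] := good3 i j k iS jS kS; last by exists u.
    by rewrite /= !inE negb_or ij eq_sym ki eq_sym kj.
  have Sface : face A S.
    apply: (helly A_cvx A_ne) => i j k iS jS kS.
    have [<-|ij] := eqVneq i j; first by have [u iu ku] := pair i k iS kS; exists u.
    have [<-|ik] := eqVneq i k; first by have [u iu ju] := pair i j iS jS; exists u.
    have [<-|jk] := eqVneq j k; first by have [u iu ju] := pair i j iS jS; exists u.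
    by apply: good3 => //; rewrite /= !inE negb_or ij ik jk.
  by exists S, S; split=> //; rewrite finset.subsetUl.
move=> CM CM'; have [y Cy] := A_ne C.
have [fy|fy] := ltP (aff f y) 0; first by left; apply: (H f g y).
right; rewrite -[g in missing _ g]opfK; apply: (H (opf f) (opf g) y); rewrite ?opfK //.
rewrite aff_opf oppr_lt0 lt_neqAle fy andbT; apply/eqP => fy0.
have := missingP CM Cy; have := missingP CM' Cy; rewrite !aff_opf; lra.
Qed.

Lemma fan_sides f g C C' D z : det f g != 0 -> uniq [:: C; C'; D] ->
    C \in missing f g -> C' \in missing f g -> D \in missing (opf f) (opf g) ->
    A C z -> A C' z -> A D z ->
    (forall y, A C y -> A C' y -> aff f y != 0 /\ aff g y != 0) ->
  two_faces A (missing f (opf g)) \/ two_faces A (missing (opf f) g).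
Proof.
move=> fg u3 CM C'M DM Cz C'z Dz off.
have [fz|fz] := ltP (aff f z) 0; first by left; apply: (fan fg u3 CM C'M DM Cz C'z Dz).
right; rewrite missingC; apply: (@fan g f C C' D z) => //.
- by move: fg; rewrite /det -oppr_eq0 opprB mulrC [f.1.1 * _]mulrC.
- by rewrite missingC.
- by rewrite missingC.
- by rewrite missingC.
- rewrite -oppr_gt0 -aff_opf; apply: (missingP DM Dz).
  by rewrite aff_opf oppr_le0.
- by move=> y Cy C'y; have [? ?] := off y Cy C'y.
Qed.

(** Otherwise each of two opposite quadrants has two sets missing it that do not meet on the lines,
    and these four sets are distinct by [missing_inter]. Three of them have a common point; they
    comprise both sets of one pair and one of the other, the situation of [fan_sides] for the cross
    or its opposite. *)
Theorem quadrants f g : det f g != 0 ->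
  [\/ two_faces A (missing f g), two_faces A (missing f (opf g)),
      two_faces A (missing (opf f) g) | two_faces A (missing (opf f) (opf g))].
Proof.
move=> fg; apply: contrapT => none.
have n1 : ~ two_faces A (missing f g) by move=> ?; apply: none; constructor 1.
have n4 : ~ two_faces A (missing (opf f) (opf g)).
  by move=> ?; apply: none; constructor 4.
have no : ~ (two_faces A (missing f (opf g)) \/ two_faces A (missing (opf f) g)).
  by case=> ?; apply: none; [constructor 2|constructor 3].
have fg' : det (opf f) (opf g) != 0.
  by rewrite (_ : det _ _ = det f g) // /det /=; ring.
have [C [C' [CM C'M CC' Coff]]] := not_on_lines fg n1.
have [D [D' [DM D'M DD' Doff]]] := not_on_lines fg' n4.
have apart i j : i \in missing f g -> j \in missing (opf f) (opf g) -> i != j.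
  move=> iM jM; apply/eqP => ij; rewrite -ij in jM.
  exact: no (missing_inter iM jM).
have n := apart _ _ CM DM; have n' := apart _ _ C'M DM.
have m := apart _ _ CM D'M; have m' := apart _ _ C'M D'M.
have /A43[] : uniq [:: C; C'; D; D'] by rewrite /= !inE !negb_or CC' n m n' m' DD'.
- case=> z [Cz C'z Dz]; apply: no; apply: (fan_sides fg _ CM C'M DM Cz C'z Dz Coff).
  by rewrite /= !inE negb_or CC' n n'.
- case=> z [Cz C'z Dz]; apply: no; apply: (fan_sides fg _ CM C'M D'M Cz C'z Dz Coff).
  by rewrite /= !inE negb_or CC' m m'.
- case=> z [Cz Dz D'z]; apply: no;
  rewrite orC -[f in missing f (opf g)]opfK -[g in missing _ g]opfK.
  apply: (fan_sides fg' _ DM D'M _ Dz D'z Cz Doff); rewrite ?opfK //.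
  by rewrite /= !inE negb_or DD' eq_sym n eq_sym m.
- case=> z [Cz Dz D'z]; apply: no;
  rewrite orC -[f in missing f (opf g)]opfK -[g in missing _ g]opfK.
  apply: (fan_sides fg' _ DM D'M _ Dz D'z Cz Doff); rewrite ?opfK //.
  by rewrite /= !inE negb_or DD' eq_sym n' eq_sym m'.
Qed.

End Family.
End Quadrants.

(** * Compactness *)

Section Cluster.
Variable R : realType.

(** A Heine-Borel argument: the cluster point is the supremum of the t such that, for some e, [Q e]
    fails on all of [lo, t]. If [Q e] also failed near it, the supremum could be moved up, or some
    [Q d] would fail on all of [lo, hi]. *)
Lemma cluster_segment (Q : R -> R -> Prop) lo hi :
    (forall e e' x, e <= e' -> Q e x -> Q e' x) ->
    (forall e, 0 < e -> exists2 x, lo <= x <= hi & Q e x) ->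
  exists2 x0, lo <= x0 <= hi &
    forall e, 0 < e -> exists x, [/\ lo <= x <= hi, `|x - x0| < e & Q e x].
Proof.
move=> Qmon Qex; have lohi : lo <= hi.
  by have [x /andP[? ?] _] := Qex 1 ltr01; lra.
pose E := [set t | lo <= t <= hi /\ (t = lo \/
  exists2 e, 0 < e & forall x, lo <= x <= t -> ~ Q e x)].
have Elo : E lo by split; [lra|left].
have Eub : ubound E hi by move=> t [/andP[]].
have Esup : has_sup E by split; [exists lo|exists hi].
have lo_sup : lo <= sup E by apply: ub_le_sup => //; exists hi.
have sup_hi : sup E <= hi by apply: ge_sup => //; exists lo.
exists (sup E) => [|e e0]; first by rewrite lo_sup.
apply: contrapT => no; have [t [/andP[lot thi] tE] te] := sup_adherent e0 Esup.
pose u := Num.min (sup E + e / 2) hi.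
have uhi : u <= hi by rewrite ge_min lexx orbT.
have usup : u <= sup E + e / 2 by rewrite ge_min lexx.
have lou : lo <= u by rewrite le_min lohi andbT; lra.
have noQ x : sup E - e < x -> lo <= x <= u -> ~ Q e x.
  move=> xe /andP[lox xu] Qx; apply: no; exists x; split=> //; first by lra.
  by rewrite ltr_norml; lra.
have [d d0 noQu] : exists2 d, 0 < d & forall x, lo <= x <= u -> ~ Q d x.
  case: tE => [tlo|[d d0 dP]].
    by exists e => // x xu; apply: noQ => //; move: xu => /andP[? _]; lra.
  exists (Num.min d e) => [|x /andP[lox xu] Qx]; first by rewrite lt_min d0.
  have [xt|tx] := leP x t.
    by apply: (dP x); [lra|apply: Qmon Qx; rewrite ge_min lexx].
  by apply: (noQ x); [lra|lra|apply: Qmon Qx; rewrite ge_min lexx orbT].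
have Eu : E u by split; [rewrite lou|right; exists d].
have : u <= sup E by apply: ub_le_sup => //; exists hi.
rewrite /u /Num.min; case: ifP => [|_ hisup]; first by lra.
have uE : u = hi by apply: le_anti; rewrite uhi /u le_min lexx andbT; lra.
by have [x xhi] := Qex d d0; apply: noQu; rewrite uE.
Qed.

Lemma cluster_square (Q : R -> R -> R -> Prop) lo hi :
    (forall e e' x y, e <= e' -> Q e x y -> Q e' x y) ->
    (forall e, 0 < e -> exists x y, [/\ lo <= x <= hi, lo <= y <= hi & Q e x y]) ->
  exists x0 y0, forall e, 0 < e ->
    exists x y, [/\ `|x - x0| < e, `|y - y0| < e & Q e x y].
Proof.
move=> Qmon Qex.
have [|e e0|x0 _ x0P] := @cluster_segment (fun e x => exists2 y,
  lo <= y <= hi & Q e x y) lo hi.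
- by move=> e e' x ee' [y yP Qy]; exists y => //; apply: Qmon Qy.
- by have [x [y [xP yP Qxy]]] := Qex e e0; exists x => //; exists y.
have [|e e0|y0 _ y0P] := @cluster_segment (fun e y => exists2 x,
  `|x - x0| < e & Q e x y) lo hi.
- by move=> e e' y ee' [x xP Qx]; exists x; [exact: lt_le_trans ee'|exact: Qmon Qx].
- by have [x [_ xP [y yP Qxy]]] := x0P e e0; exists y => //; exists x.
exists x0, y0 => e e0; have [y [_ yP [x xP Qxy]]] := y0P e e0.
by exists x, y.
Qed.

Lemma cluster_cube (Q : R -> R -> R -> R -> Prop) lo hi :
    (forall e e' x y z, e <= e' -> Q e x y z -> Q e' x y z) ->
    (forall e, 0 < e -> exists x y z,
      [/\ lo <= x <= hi, lo <= y <= hi, lo <= z <= hi & Q e x y z]) ->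
  exists x0 y0 z0, forall e, 0 < e ->
    exists x y z, [/\ `|x - x0| < e, `|y - y0| < e, `|z - z0| < e & Q e x y z].
Proof.
move=> Qmon Qex.
have [|e e0|x0 _ x0P] := @cluster_segment (fun e x => exists y z, [/\ lo <= y <= hi,
  lo <= z <= hi & Q e x y z]) lo hi.
- by move=> e e' x ee' [y [z [yP zP Qy]]]; exists y, z; split=> //; apply: Qmon Qy.
- by have [x [y [z [xP yP zP Qxyz]]]] := Qex e e0; exists x => //; exists y, z.
have [||y0 [z0 yzP]] := @cluster_square (fun e y z => exists2 x,
  `|x - x0| < e & Q e x y z) lo hi.
- by move=> e e' y z ee' [x xP Qx]; exists x; [exact: lt_le_trans ee'|exact: Qmon Qx].
- by move=> e e0; have [x [_ xP [y [z [yP zP Qxyz]]]]] := x0P e e0; exists y, z;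
  split=> //; exists x.
exists x0, y0, z0 => e e0; have [y [z [yP zP [x xP Qxyz]]]] := yzP e e0.
by exists x, y, z.
Qed.

End Cluster.

(** * Compact hulls of finite sets and thickening *)

Section Hull.
Variable R : realType.
Local Notation V := 'rV[R]_2.
Implicit Types (p q y z : V) (X : set V).

Lemma cone_continuous p : continuous (fun tq : R * V => (1 - tq.1) *: p + tq.1 *: tq.2).
Proof.
move=> tq; apply: cvgD.
  by apply: cvgZr_tmp; apply: cvgB; [exact: cvg_cst|exact: cvg_fst].
by apply: cvgZ; [exact: cvg_fst|exact: cvg_snd].
Qed.

(** Each new point p is joined to the hull K of the others; the join is the continuous image of
    [0, 1] x K, hence compact. *)
Lemma hull_exists (s : seq V) : s != [::] -> exists K, [/\ compact K, cvx K,
  {in s, forall p, K p} & forall X, cvx X -> {in s, forall p, X p} -> K `<=` X].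
Proof.
elim: s => // p s IH _; have [->|s0] := eqVneq s [::].
  exists [set p]; split.
  - exact: compact_set1.
  - by move=> u v t /= -> -> _ _; rewrite -scalerDl subrK scale1r.
  - by move=> q; rewrite inE => /eqP.
  - by move=> X _ Xp _ ->; apply: Xp; exact: mem_head.
have [K [Kc Kcvx Ks Kmin]] := IH s0.
exists ((fun tq : R * V => (1 - tq.1) *: p + tq.1 *: tq.2) @` (`[0, 1] `*` K)); split.
- apply: continuous_compact; last exact: compact_setX (@segment_compact _ _ _) Kc.
  by apply: continuous_subspaceT; exact: cone_continuous.
- move=> u v l [[t q] /= [/[!in_itv]/= /andP[t0 t1] Kq] <-].
  move=> [[t' q'] /= [/[!in_itv]/= /andP[t'0 t'1] Kq'] <-] l0 l1.
  (* T is the total weight put on K; the points q and q' merge into one point of K unless T = 0,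
     when only p is left. *)
  pose T := (1 - l) * t + l * t'.
  have ? : 0 <= (1 - l) * t by rewrite mulr_ge0 // subr_ge0.
  have ? : 0 <= l * t' by rewrite mulr_ge0.
  have T1 : T <= 1 by rewrite /T; nra.
  have E : (1 - l) *: ((1 - t) *: p + t *: q) + l *: ((1 - t') *: p + t' *: q') =
      (1 - T) *: p + ((1 - l) * t) *: q + (l * t') *: q'.
    by apply: row2P; rewrite !mxE /T; ring.
  have [T0|Tn] := eqVneq T 0.
    exists (0, q) => /=; first by rewrite in_itv /= lexx ler01.
    have e1 : (1 - l) * t = 0 by move: T0; rewrite /T; lra.
    have e2 : l * t' = 0 by move: T0; rewrite /T; lra.
    by rewrite E e1 e2 T0 !scale0r !addr0.
  have Tp : 0 < T by rewrite lt_neqAle eq_sym Tn /T; lra.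
  exists (T, (1 - (l * t') / T) *: q + ((l * t') / T) *: q') => /=.
    rewrite in_itv /= T1 ltW //; split=> //; apply: Kcvx => //.
      by rewrite divr_ge0 // ltW.
    by rewrite ler_pdivrMr // mul1r /T; lra.
  rewrite scalerDr !scalerA.
  have -> : T * (1 - l * t' / T) = (1 - l) * t by rewrite mulrBr mulr1 mulrC divfK //
    /T; ring.
  have -> : T * (l * t' / T) = l * t' by rewrite mulrC divfK.
  by rewrite E addrA.
- move=> q; rewrite inE => /predU1P[->|/Ks Kq].
    case: s s0 Ks {IH Kmin} => // q0 s _ Ks.
    exists (0, q0) => /=; last by rewrite subr0 scale1r scale0r addr0.
    by split; [rewrite in_itv /= lexx ler01|apply: Ks; exact: mem_head].
  by exists (1, q); rewrite /= ?in_itv /= ?ler01 ?lexx // subrr scale0r add0r scale1r.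
move=> X cX Xs _ [[t q] /= [/[!in_itv]/= /andP[t0 t1] Kq] <-].
apply: (cX _ _ _ (Xs p (mem_head _ _)) _ t0 t1).
by apply: (Kmin X cX _ q Kq) => u us; apply: Xs; rewrite inE us orbT.
Qed.

Lemma compact_adherent X y : compact X ->
  (forall e, 0 < e -> exists a, [/\ X a,
    `|a 0 0 - y 0 0| < e & `|a 0 1 - y 0 1| < e]) -> X y.
Proof.
move=> /compact_closed Xc H; apply: Xc; first exact: norm_hausdorff.
move=> B /nbhs_ballP[e /= e0 eB]; have [a [Xa a0 a1]] := H e e0.
exists a; split=> //; apply: eB; split=> // i j; rewrite ord1; case: j => [[|[|//]] j2].
  rewrite (_ : Ordinal j2 = 0); last exact/val_inj.
  by rewrite -ball_normE /= distrC.
rewrite (_ : Ordinal j2 = 1); last exact/val_inj.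
by rewrite -ball_normE /= distrC.
Qed.

Definition thick (e : R) X : set V :=
  [set y | exists a, [/\ X a, `|y 0 0 - a 0 0| <= e & `|y 0 1 - a 0 1| <= e]].

Lemma thick_cvx e X : cvx X -> cvx (thick e X).
Proof.
move=> cX p q t [a [Xa a0 a1]] [b [Xb b0 b1]] t0 t1.
exists ((1 - t) *: a + t *: b); split; first exact: cX.
  move: a0 b0; rewrite !mxE !ler_norml => /andP[? ?] /andP[? ?]; apply/andP; split; nra.
move: a1 b1; rewrite !mxE !ler_norml => /andP[? ?] /andP[? ?]; apply/andP; split; nra.
Qed.

Lemma thick_le e e' X : e <= e' -> thick e X `<=` thick e' X.
Proof.
by move=> ee' p [a [Xa a0 a1]]; exists a; split=> //; apply: le_trans ee'.
Qed.

(** If a subfamily had common points after every thickening, a cluster point of these would lie in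
    all its compact members. There are finitely many subfamilies, so a least e works for all; the
    bound e <= 1 keeps the thickened family in a box fixed in advance. *)
Lemma thick_nerve (I : finType) (A : I -> set V) (M : R) :
    (forall i, compact (A i)) ->
    (forall i y, A i y -> `|y 0 0| <= M /\ `|y 0 1| <= M) ->
  exists e, [/\ 0 < e, e <= 1 & forall S : {set I},
    face (fun i => thick e (A i)) S -> face A S].
Proof.
move=> Ac AM.
have Sex (S : {set I}) : exists2 e, 0 < e & face (fun i => thick e (A i)) S -> face A S.
  apply: contrapT => no; have nf : ~ face A S by move=> fS; apply: no; exists 1.
  have [S0|[i0 i0S]] := set_0Vmem S; first by apply: nf; rewrite S0; exact: face0.
  have all e : 0 < e -> face (fun i => thick e (A i)) S.
    by move=> e0; apply: contrapT => nfe; apply: no; exists e.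
  have [||x0 [y0 xyP]] := @cluster_square R (fun e (x y : R) => exists p : V,
      [/\ p 0 0 = x, p 0 1 = y & forall i, i \in S -> thick e (A i) p]) (- M - 1) (M + 1).
  - move=> e e' x y ee' [p [px py pP]]; exists p; split=> // i /pP.
    exact: thick_le.
  - move=> e e0; have e1 : 0 < Num.min e 1 by rewrite lt_min e0 ltr01.
    have [p pP] := all _ e1; exists (p 0 0), (p 0 1).
    have [a [Aa a0 a1]] := pP i0 i0S; have [] := AM i0 a Aa.
    have ? : Num.min e 1 <= 1 by rewrite ge_min lexx orbT.
    move: a0 a1; rewrite !ler_norml => /andP[? ?] /andP[? ?] /andP[? ?] /andP[? ?].
    split; [by apply/andP; split; lra|by apply/andP; split; lra|].
    exists p; split=> // i /pP; apply: thick_le.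
    by rewrite ge_min lexx.
  apply: nf; exists (\row_j (if j == 0 then x0 else y0)) => i iS.
  apply: compact_adherent => // e e0; rewrite !mxE /=.
  have [x [y [xx0 yy0 [p [px py pP]]]]] := xyP (e / 2) ltac:(lra).
  have [a [Aa a0 a1]] := pP i iS; exists a; rewrite px py in a0 a1; split=> //.
    by move: a0 xx0; rewrite !ltr_norml !ler_norml => /andP[? ?] /andP[? ?];
      apply/andP; split; lra.
  by move: a1 yy0; rewrite !ltr_norml !ler_norml => /andP[? ?] /andP[? ?];
    apply/andP; split; lra.
have [S|e eP] := @choice {set I} R (fun S e =>
    0 < e /\ (face (fun i => thick e (A i)) S -> face A S)).
  by have [e ? ?] := Sex S; exists e.
exists (\big[Num.min/1]_S e S); split.
- by apply: lt_bigmin => // S _; have [] := eP S.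
- exact: bigmin_le_id.
move=> S [y yP]; have [_ H] := eP S; apply: H; exists y => i /yP.
by apply: thick_le; exact: bigmin_le_cond.
Qed.

End Hull.

(** * Crosses inscribed in a parabola *)

Section Crosses.
Variables (R : realType) (K : R).
Local Notation V := 'rV[R]_2.
Implicit Types (p q y z : V) (X : set V) (f g : R * R * R) (a b c s t : R).

(* Vertical line through the point of parameter s / (1 - s ^ 2) of the
   parabola y + K = x ^ 2, and line through two points of the parabola; the
   parameters -1 and 1 both stand for the point at infinity. *)
Definition vert s : R * R * R := (1 - s ^+ 2, 0, - s).

Definition chord s t : R * R * R :=
  (- (s * (1 - t ^+ 2) + t * (1 - s ^+ 2)), (1 - s ^+ 2) * (1 - t ^+ 2),
   (1 - s ^+ 2) * (1 - t ^+ 2) * K + s * t).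

(** The chord and the product of the vertical lines through its ends differ by a multiple of the
    equation of the parabola, nonnegative above it. Hence a point above the parabola and below the
    chord lies strictly between the two verticals. *)
Lemma chordE s t y : aff (chord s t) y = aff (vert s) y * aff (vert t) y +
  (1 - s ^+ 2) * (1 - t ^+ 2) * (y 0 1 + K - y 0 0 ^+ 2).
Proof. by rewrite /aff /=; ring. Qed.

Lemma vert_mono s t y : -1 <= s -> s <= t -> t <= 1 ->
  aff (vert s) y <= 0 -> aff (vert t) y <= 0.
Proof.
rewrite /aff /= !mul0r !addr0 => s1 st t1 sy.
have vs : 0 <= 1 - s ^+ 2 by nra.
have vt : 0 <= 1 - t ^+ 2 by nra.
(* The inequality s / (1 - s ^ 2) <= t / (1 - t ^ 2) with denominators cleared, so as to include the
   points at infinity. *)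
have uv : s * (1 - t ^+ 2) <= t * (1 - s ^+ 2).
  rewrite -subr_ge0 (_ : _ - _ = (t - s) * (1 + s * t)); last by ring.
  by rewrite mulr_ge0 ?subr_ge0 //; nra.
move: vs; rewrite le_eqVlt => /predU1P[v0|v_gt0].
  have s0 : 0 <= s by move: sy; rewrite -v0 mul0r; lra.
  have s_1 : s = 1 by nra.
  have -> : t = 1 by lra.
  by rewrite expr1n; lra.
have : (1 - s ^+ 2) * ((1 - t ^+ 2) * y 0 0 - t) <= 0 by nra.
by rewrite pmulr_rle0.
Qed.

Definition quad a b c (i : 'I_4) : (R * R * R) * (R * R * R) :=
  nth (vert b, chord a c) [:: (vert b, opf (chord a c)); (vert b, chord a c);
    (opf (vert b), chord a c); (opf (vert b), opf (chord a c))] i.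

Definition inside X := forall y, X y -> y 0 0 ^+ 2 <= y 0 1 + K.

Definition params a b c := [/\ -1 <= a, a <= b, b <= c & c <= 1].

(* The i-th quadrant degenerates when the i-th gap between the parameters
   -1, a, b, c, 1 vanishes. *)
Definition gap a b c (i : 'I_4) := nth 0 [:: a + 1; b - a; c - b; 1 - c] i.

(** Above the parabola a negative chord puts the point between the verticals at a and c, so for b =
    a or b = c one side of the vertical at b is empty there. For a = -1 or c = 1 the chord becomes
    the vertical line at c or at a, and the quadrant would lie on incompatible sides of two ordered
    verticals. *)
Lemma quad_empty a b c i y : params a b c -> gap a b c i = 0 ->
    y 0 0 ^+ 2 <= y 0 1 + K ->
  ~ (aff (quad a b c i).1 y < 0 /\ aff (quad a b c i).2 y < 0).
Proof.
case=> a1 ab bc c1 gap0 yK.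
have va : 0 <= 1 - a ^+ 2 by nra.
have vc : 0 <= 1 - c ^+ 2 by nra.
have ch : aff (vert a) y * aff (vert c) y <= aff (chord a c) y.
  by rewrite chordE lerDl mulr_ge0 ?mulr_ge0 //; lra.
have ba := @vert_mono a b y a1 ab (le_trans bc c1).
have cb := @vert_mono b c y (le_trans a1 ab) bc c1.
case: i gap0 => -[|[|[|[|//]]]] i4; rewrite /gap /quad /= ?aff_opf => gap0 [f0 g0].
- have aE : a = -1 by lra.
  have := cb (ltW f0); rewrite aE in g0; move: g0; rewrite chordE /aff /=; lra.
- have aE : a = b by lra.
  by have := cb (ltW f0); rewrite aE in ch g0; nra.
- have cE : c = b by lra.
  have : 0 <= aff (vert a) y by rewrite leNgt; apply/negP => /ltW/ba; lra.
  by rewrite cE in ch g0; nra.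
- have cE : c = 1 by lra.
  have : 0 <= aff (vert a) y by rewrite leNgt; apply/negP => /ltW/ba; lra.
  by move: g0; rewrite cE chordE /aff /=; lra.
Qed.

Lemma poly_near (F : R -> R -> R -> R) a b c :
    continuous (fun q : R * R * R => F q.1.1 q.1.2 q.2) -> F a b c < 0 ->
  exists2 d, 0 < d & forall a' b' c', `|a - a'| < d -> `|b - b'| < d ->
    `|c - c'| < d -> F a' b' c' < 0.
Proof.
move=> /(_ (a, b, c)) Fc F0.
have : nbhs (F a b c) [set x | x < 0] by exact: lt_nbhsl.
move=> /Fc/nbhs_ballP[d /= d0 dP]; exists d => // a' b' c' aa bb cc.
exact: (dP (a', b', c')).
Qed.

Let Rc (F : R * R * R -> R) := continuous F.

Let cst x : Rc (fun=> x). Proof. by move=> q; exact: cvg_cst. Qed.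

Let add F G : Rc F -> Rc G -> Rc (fun w => F w + G w).
Proof. by move=> Fc Gc q; apply: cvgD; [exact: Fc|exact: Gc]. Qed.

Let mul F G : Rc F -> Rc G -> Rc (fun w => F w * G w).
Proof. by move=> Fc Gc q; apply: cvgM; [exact: Fc|exact: Gc]. Qed.

Let opp F : Rc F -> Rc (fun w => - F w).
Proof. by move=> Fc q; apply: cvgN; exact: Fc. Qed.

Let sqr F : Rc F -> Rc (fun w => F w ^+ 2).
Proof. exact: (fun Fc => mul Fc Fc). Qed.

Ltac cont := rewrite -/(Rc _); repeat first [assumption | simple apply cst
  | simple apply add | simple apply mul | simple apply sqr | simple apply opp].

Lemma quad_near a b c i y : aff (quad a b c i).1 y < 0 /\ aff (quad a b c i).2 y < 0 ->
  exists2 d, 0 < d & forall a' b' c', `|a - a'| < d -> `|b - b'| < d ->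
    `|c - c'| < d -> aff (quad a' b' c' i).1 y < 0 /\ aff (quad a' b' c' i).2 y < 0.
Proof.
move=> [f0 g0].
have c1 : Rc (fun q : R * R * R => q.1.1).
  by move=> q; apply: (cvg_comp _ _ cvg_fst); exact: cvg_fst.
have c2 : Rc (fun q : R * R * R => q.1.2).
  by move=> q; apply: (cvg_comp _ _ cvg_fst); exact: cvg_snd.
have c3 : Rc (fun q : R * R * R => q.2) by move=> q; exact: cvg_snd.
have [d d0 dP] : exists2 d, 0 < d & forall a' b' c', `|a - a'| < d -> `|b - b'| < d ->
    `|c - c'| < d -> aff (quad a' b' c' i).1 y < 0.
  apply: (@poly_near (fun a b c => aff (quad a b c i).1 y)) => //.
  by case: i f0 g0 => -[|[|[|[|//]]]] i4 *; rewrite /quad /aff /=; cont.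
have [e e0 eP] : exists2 d, 0 < d & forall a' b' c', `|a - a'| < d -> `|b - b'| < d ->
    `|c - c'| < d -> aff (quad a' b' c' i).2 y < 0.
  apply: (@poly_near (fun a b c => aff (quad a b c i).2 y)) => //.
  by case: i f0 g0 dP => -[|[|[|[|//]]]] i4 *; rewrite /quad /aff /=; cont.
exists (Num.min d e) => [|a' b' c']; first by rewrite lt_min d0.
by rewrite !lt_min => /andP[? ?] /andP[? ?] /andP[? ?]; split; [exact: dP|exact: eP].
Qed.

End Crosses.

(** * A colourful room in the simplex grid *)

Section Grid.
Variable n : nat.
Local Open Scope nat_scope.

Definition grid_pred (x : {ffun 'I_4 -> 'I_n.+2}) := \sum_i x i == n.+1.
Definition grid := {x | grid_pred x}.

Lemma grid_at (z : 'I_4 -> nat) : \sum_i z i = n.+1 ->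
  exists x : grid, forall i, val x i = z i :> nat.
Proof.
move=> zN; have zl i : z i < n.+2 by rewrite ltnS -zN (bigD1 i) //= leq_addr.
have zP : grid_pred [ffun i => Ordinal (zl i)].
  by rewrite /grid_pred -[X in _ == X]zN; apply/eqP/eq_bigr => i _; rewrite ffunE.
by exists (exist (fun x => grid_pred x) _ zP) => i; rewrite /= ffunE.
Qed.

(** If the minima m of a colourful room, raised by one in each coordinate of C, had sum at most n +
    1, some grid point would exceed them all, against dominance. Hence m has sum at least n + 1 - 3,
    and every point of the room is within 3 of m in each coordinate. The 3 is the four coordinates
    less one; outside C the value 0 of m makes the coordinate itself at most 3. *)
Lemma grid_colour (col : grid -> 'I_4) : exists x0 : grid, forall i : 'I_4,
  val x0 i <= 3 \/ exists2 x : grid, col x = i &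
    forall k, val x k <= val x0 k + 3 /\ val x0 k <= val x k + 3.
Proof.
pose z0 (i : 'I_4) := if i == ord0 then n.+1 else 0.
have [t0 _] : exists x : grid, forall i, val x i = z0 i :> nat.
  by apply: grid_at; rewrite (bigD1 ord0) //= big1 ?addn0 // => i /negPf i0;
    rewrite /z0 i0.
(* The i-th coordinate, with ties broken by the enumeration to make the ranking injective. *)
pose r (i : 'I_4) (x : grid) := (val x i : nat) * #|{: grid}| + enum_rank x.
have r_inj i : injective (r i).
  move=> x y /(congr1 (modn^~ #|{: grid}|)).
  by rewrite !modnMDl !modn_small ?ltn_ord // => /ord_inj/enum_rank_inj.
have [s [C [/dominantP dom cs]]] := colourful_room col t0 r_inj.
have [x0 x0s] : exists x0, x0 \in s.
  by have [i] := dom t0; rewrite -cs => /imsetP[x xs _]; exists x.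
pose low k := [arg min_(x < x0 in s) (val x k : nat)].
have lowP k : low k \in s /\ forall x, x \in s -> val (low k) k <= val x k.
  by rewrite /low; case: arg_minnP => // x xs xmin.
pose m k := if k \in C then (val (low k) k : nat) else 0.
have mP x k : x \in s -> m k <= val x k.
  by move=> xs; rewrite /m; case: ifP => // _; apply: (lowP k).2.
have sumC : n.+1 < \sum_(k in C) (m k).+1.
  rewrite ltnNge; apply/negP => mN; have [i0 i0C _] := dom t0.
  (* One above each minimum in C, with the excess put on [i0] to reach the sum n + 1. *)
  pose z k := (if k \in C then (m k).+1 else 0) +
    (if k == i0 then n.+1 - \sum_(k in C) (m k).+1 else 0).
  have [y yE] : exists y : grid, forall i, val y i = z i :> nat.
    apply: grid_at; rewrite big_split /= -big_mkcond /= -big_mkcond /= big_pred1_eq.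
    exact: subnKC.
  have [k kC /belowP/(_ _ (lowP k).1)] := dom y.
  have : val (low k) k < val y k by rewrite yE /z kC /m kC leq_addr.
  move=> lk; rewrite /r leqNgt => /negP; apply.
  apply: (@leq_trans ((val (low k) k).+1 * #|{: grid}|)).
    by rewrite mulSn addnC ltn_add2r ltn_ord.
  by rewrite (leq_trans _ (leq_addr _ _)) // leq_mul2r lk orbT.
have m3 : n.+1 <= \sum_k m k + 3.
  have : \sum_(k in C) (m k).+1 <= \sum_k m k + 4.
    rewrite [X in _ <= X + _](bigID [in C]) /=.
    rewrite -addnA; under eq_bigr do rewrite -addn1.
    rewrite big_split /= sum1_card leq_add2l.
    by rewrite (leq_trans (max_card _)) ?card_ord ?leq_addl.
  by move=> /(leq_trans sumC); rewrite addnS ltnS.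
have near x k : x \in s -> val x k <= m k + 3.
  move=> xs; have /eqP xN := valP x.
  have : \sum_(i | i != k) m i <= \sum_(i | i != k) val x i.
    by apply: leq_sum => i _; apply: mP.
  move: m3 xN; rewrite (bigD1 k) //= [X in X = _](bigD1 k) //=.
  by lia.
exists x0 => i; have [iC|iC] := boolP (i \in C); last first.
  by left; have := near x0 i x0s; rewrite /m (negPf iC).
right; move: iC; rewrite -cs => /imsetP[x xs ->]; exists x => // k.
have := near x k xs; have := near x0 k x0s.
have := mP x k xs; have := mP x0 k x0s.
move: (nat_of_ord _) (nat_of_ord _) (m k) => u v w *; lia.
Qed.

End Grid.

(** * A cross bad for all quadrants *)

Section Avoid.
Variables (R : realType) (I : finType).
Local Notation V := 'rV[R]_2.
Implicit Types (p q y z : V) (X : set V) (f g : R * R * R).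

Variables (A : I -> set V) (e : R) (K : R).
Hypotheses (A_cvx : forall i, cvx (A i)) (A_ne : forall i, A i !=set0).
Hypothesis e_gt0 : 0 < e.
Local Notation B i := (thick e (A i)).
Hypothesis B_face : forall S, face (fun i => B i) S -> face A S.
Hypothesis B_inside : forall i, inside K (B i).

Definition avoid f g : {set I} :=
  [set i | `[< forall y, B i y -> ~ (aff f y < 0 /\ aff g y < 0) >]]%SET.

Definition avoid_quad a b c i := avoid (quad K a b c i).1 (quad K a b c i).2.

(** A point witnessing that a thickened set reaches an open quadrant remains a witness for nearby
    parameters; d is the least of finitely many such radii. *)
Lemma avoid_near a b c : exists2 d, 0 < d & forall a' b' c', `|a - a'| < d ->
  `|b - b'| < d -> `|c - c'| < d -> forall i,
  avoid_quad a' b' c' i \subset avoid_quad a b c i.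
Proof.
have H (ij : 'I_4 * I) : exists d, 0 < d /\ forall a' b' c', `|a - a'| < d ->
    `|b - b'| < d -> `|c - c'| < d ->
    ij.2 \in avoid_quad a' b' c' ij.1 -> ij.2 \in avoid_quad a b c ij.1.
  have [|nav] := boolP (ij.2 \in avoid_quad a b c ij.1); first by exists 1.
  have [y By yq] : exists2 y, B ij.2 y & aff (quad K a b c ij.1).1 y < 0 /\
      aff (quad K a b c ij.1).2 y < 0.
    apply: contrapT => no; move/negP: nav; apply; rewrite inE; apply/asboolP => y By yq.
    by apply: no; exists y.
  have [d d0 dP] := quad_near yq; exists d; split=> // a' b' c' aa bb cc.
  by rewrite inE => /asboolP/(_ y By)[]; exact: dP.
have [d dP] := choice H.
exists (\big[Num.min/1]_ij d ij) => [|a' b' c' aa bb cc i].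
  by apply: lt_bigmin => // ij _; have [] := dP ij.
apply/fintype.subsetP => j; have [_] := dP (i, j); apply.
- by apply: lt_le_trans aa _; exact: bigmin_le_cond.
- by apply: lt_le_trans bb _; exact: bigmin_le_cond.
- by apply: lt_le_trans cc _; exact: bigmin_le_cond.
Qed.

Lemma avoid_gap a b c i : params a b c -> gap a b c i = 0 ->
  avoid_quad a b c i = finset.setT.
Proof.
move=> abc gi; apply/setP => j; rewrite !inE; apply/asboolP => y By.
by apply: quad_empty abc gi _; exact: B_inside By.
Qed.

Lemma grid_params n (x : grid n) : let h := 2 / n.+1%:R : R in
  let a := -1 + h * (val x 0)%:R in let b := a + h * (val x 1)%:R in
  let c := b + h * (val x (inord 2))%:R in
  params a b c /\ forall i, gap a b c i = h * (val x i)%:R.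
Proof.
move=> h a b c.
have h0 : 0 < h by rewrite divr_gt0.
have hx i : 0 <= h * (val x i)%:R by rewrite mulr_ge0 // ltW.
have c1 : 1 - c = h * (val x (inord 3))%:R.
  have /eqP := valP x; rewrite 4!big_ord_recl big_ord0 addn0 => /(congr1 (fun k => h
    * k%:R)).
  have -> : lift ord0 (lift ord0 ord0) = inord 2 :> 'I_4 by apply/val_inj;
    rewrite /= inordK.
  have -> : lift ord0 (lift ord0 (lift ord0 ord0)) = inord 3 :> 'I_4 by
    apply/val_inj; rewrite /= inordK.
  have -> : lift ord0 ord0 = 1 :> 'I_4 by apply/val_inj.
  have -> : ord0 = 0 :> 'I_4 by apply/val_inj.
  rewrite !natrD /h [in RHS]divfK ?pnatr_eq0 // -/h !mulrDr => H.
  rewrite /c /b /a; move: H; rewrite /=; lra.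
have ? := hx 0; have ? := hx 1; have ? := hx (inord 2); have ? := hx (inord 3).
split; first by split; rewrite /c /b /a in c1 *; lra.
case=> -[|[|[|[|//]]]] i4; rewrite /gap /=.
- rewrite (_ : Ordinal i4 = 0); last exact/val_inj.
  by rewrite /a addrAC addNr add0r.
- rewrite (_ : Ordinal i4 = 1); last exact/val_inj.
  by rewrite /b addrAC subrr add0r.
- rewrite (_ : Ordinal i4 = inord 2); last by apply/val_inj; rewrite /= inordK.
  by rewrite /c addrAC subrr add0r.
- by rewrite (_ : Ordinal i4 = inord 3) ?c1 //; apply/val_inj; rewrite /= inordK.
Qed.

Lemma partial_sums_close (u0 u1 u2 v0 v1 v2 t d : R) : `|u0 - v0| <= t ->
    `|u1 - v1| <= t -> `|u2 - v2| <= t -> t * 3 < d ->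
  [/\ `|(-1 + u0) - (-1 + v0)| < d, `|(-1 + u0 + u1) - (-1 + v0 + v1)| < d
    & `|(-1 + u0 + u1 + u2) - (-1 + v0 + v1 + v2)| < d].
Proof.
rewrite !ler_norml !ltr_norml => /andP[? ?] /andP[? ?] /andP[? ?] ?.
by split; apply/andP; split; lra.
Qed.

(* A colourful room of a fine grid, with the parameters of the colours it does
   not use moved to the facets where the quadrant is empty; then a limit. *)
Lemma limit_cross : ~ two_faces A finset.setT ->
    (forall a b c, params a b c -> exists i, ~ two_faces A (avoid_quad a b c i)) ->
  exists a b c, params a b c /\ forall i, ~ two_faces A (avoid_quad a b c i).
Proof.
move=> nT ncross.
pose close (d a b c : R) := params a b c /\ forall i, exists a' b' c',
  [/\ `|a - a'| < d, `|b - b'| < d, `|c - c'| < d, params a' b' c'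
    & ~ two_faces A (avoid_quad a' b' c' i)].
have [|d d0|a [b [c abcP]]] := @cluster_cube R close (-1) 1.
- move=> d d' a b c dd' [abc H]; split=> // i; have [a' [b' [c' [? ? ? ? ?]]]] := H i.
  by exists a', b', c'; split=> //; apply: lt_le_trans dd'.
(* Here 18 = 2 * 3 * 3: the mesh is 2 / (n + 1), grid coordinates differ by at most 3, and c is a
   sum of three of them. *)
- have [n nd] : exists n, 18 / n.+1%:R < d.
    pose n := Num.truncn (18 / d); exists n.
    rewrite ltr_pdivrMr // -ltr_pdivrMl // mulrC; exact: truncnS_gt.
  have col (x : grid n) : exists i, let h := 2 / n.+1%:R : R in
      let a := -1 + h * (val x 0)%:R in let b := a + h * (val x 1)%:R in
      let c := b + h * (val x (inord 2))%:R in ~ two_faces A (avoid_quad a b c i).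
    by apply: ncross; exact: (grid_params x).1.
  have [co coP] := choice col; have [x0 x0P] := grid_colour co.
  have [abc gapE] := grid_params x0; move: abc gapE.
  set h := 2 / _; set a := -1 + _; set b := a + _; set c := b + _ => abc gapE.
  have h0 : 0 < h by rewrite divr_gt0.
  have hd : h * 3 * 3 < d by rewrite -mulrA /h mulrAC -!natrM.
  exists a, b, c; have [a1 ab bc c1] := abc.
  split; [by apply/andP; split; lra..|]; split=> // i.
  have [xi|[x xi near]] := x0P i; last first.
    have := coP x; rewrite xi /=; set a' := -1 + _; set b' := a' + _; set c' := b' + _.
    move=> no; have nr k : `|h * (val x0 k)%:R - h * (val x k)%:R| <= h * 3.
      rewrite -mulrBr normrM (gtr0_norm h0) ler_pM2l //.
      have [] := near k; rewrite -!(ler_nat R) !natrD => ? ?.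
      by rewrite ler_norml; apply/andP; split; lra.
    have [] := partial_sums_close (nr 0) (nr 1) (nr (inord 2)) hd.
    exists a', b', c'; split=> //; exact: (grid_params x).1.
  have gi : gap a b c i < d.
    rewrite gapE; apply: le_lt_trans hd; rewrite -mulrA ler_pM2l // -natrM ler_nat.
    exact: leq_trans xi _.
  have facet a' b' c' : params a' b' c' -> gap a' b' c' i = 0 ->
      `|a - a'| < d -> `|b - b'| < d -> `|c - c'| < d -> exists a' b' c',
      [/\ `|a - a'| < d, `|b - b'| < d, `|c - c'| < d, params a' b' c'
        & ~ two_faces A (avoid_quad a' b' c' i)].
    by move=> abc' gi0 ? ? ?; exists a', b', c'; split=> //; rewrite avoid_gap.
  case: i gi facet {xi} => -[|[|[|[|//]]]] i4; rewrite /gap /= => gi facet.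
  + apply: (facet (-1) b c); rewrite ?subrr ?normr0 ?addNr //; first by split; lra.
    by rewrite ltr_norml; apply/andP; split; lra.
  + apply: (facet b b c); rewrite ?subrr ?normr0 //; first by split; lra.
    by rewrite ltr_norml; apply/andP; split; lra.
  + apply: (facet a b b); rewrite ?subrr ?normr0 //; first by split; lra.
    by rewrite ltr_norml; apply/andP; split; lra.
  + apply: (facet a b 1); rewrite ?subrr ?normr0 //; first by split; lra.
    by rewrite ltr_norml; apply/andP; split; lra.
have lim d : 0 < d -> exists a' b' c', [/\ `|a' - a| < d, `|b' - b| < d,
  `|c' - c| < d & close d a' b' c'].
  exact: abcP.
exists a, b, c; split.
  have le (u v : R) : (forall d, 0 < d -> u - d <= v + d) -> u <= v.
    move=> H; rewrite leNgt; apply/negP => vu.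
    by have := H ((u - v) / 4) ltac:(lra); lra.
  split; apply: le => d d0; have [a' [b' [c' [+ + + [[? ? ? ?] _]]]]] := lim d d0;
    rewrite !ltr_norml => /andP[? ?] /andP[? ?] /andP[? ?]; lra.
move=> i; have [d d0 dP] := avoid_near a b c.
have [a' [b' [c' [aa bb cc [_ /(_ i)]]]]] := lim (d / 2) ltac:(lra).
case=> a2 [b2 [c2 [aa2 bb2 cc2 _]]]; apply: contra_not; apply: two_faces_sub.
by apply: dP; [move: aa aa2|move: bb bb2|move: cc cc2];
  rewrite !ltr_norml => /andP[? ?] /andP[? ?]; apply/andP; split; lra.
Qed.

End Avoid.

(** * Nine faces *)

Section Nine.
Variables (R : realType) (I : finType).
Local Notation V := 'rV[R]_2.
Implicit Types (p q y z : V) (X : set V) (f g : R * R * R).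

Definition meets_quad X f g := exists2 y, X y & aff f y < 0 /\ aff g y < 0.

(** Joining the points with f < 0, and those with f > 0, gives two points on g = 0; the segment
    between these passes through the centre. *)
Lemma cvx_centre X f g : cvx X -> meets_quad X f g -> meets_quad X f (opf g) ->
    meets_quad X (opf f) g -> meets_quad X (opf f) (opf g) ->
  exists y, [/\ X y, aff f y = 0 & aff g y = 0].
Proof.
move=> cX [y1 X1 [f1 g1]] [y2 X2 [f2 g2]] [y3 X3 [f3 g3]] [y4 X4 [f4 g4]].
rewrite !aff_opf in g2 f3 f4 g4.
have [|t [t0 t1 Xt gt]] := cvx_zero (f := g) cX X1 X2; first by nra.
have [|u [u0 u1 Xu gu]] := cvx_zero (f := g) cX X3 X4; first by nra.
have ft : aff f ((1 - t) *: y1 + t *: y2) < 0 by rewrite aff_seg; nra.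
have fu : 0 < aff f ((1 - u) *: y3 + u *: y4) by rewrite aff_seg; nra.
have [|v [v0 v1 Xv fv]] := cvx_zero (f := f) cX Xt Xu; first by nra.
by eexists; split; [exact: Xv|exact: fv|rewrite aff_seg gt gu; ring].
Qed.

Lemma det_witness f g u v : det f g != 0 -> exists y, aff f y = u /\ aff g y = v.
Proof.
move=> fg; exists (\row_j (if j == 0 then
    ((u - f.2) * g.1.2 - (v - g.2) * f.1.2) / det f g
  else (f.1.1 * (v - g.2) - g.1.1 * (u - f.2)) / det f g)).
by split; rewrite /aff !mxE /= /det; field.
Qed.

Variables (A : I -> set V) (e : R) (K : R).
Hypotheses (A_cvx : forall i, cvx (A i)) (A_ne : forall i, A i !=set0).
Hypothesis A43 : forall i j k l, uniq [:: i; j; k; l] ->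
  [\/ good A i j k, good A i j l, good A i k l | good A j k l].
Hypothesis e_gt0 : 0 < e.
Local Notation B i := (thick e (A i)).
Hypothesis B_face : forall S, face (fun i => B i) S -> face A S.
Hypothesis B_inside : forall i, inside K (B i).
Local Notation avoid := (avoid A e).
Local Notation avoid_quad := (avoid_quad A e K).

Lemma avoidPn f g j : j \notin avoid f g -> meets_quad (B j) f g.
Proof.
move=> /negP jf; apply: contrapT => no; apply: jf; rewrite inE; apply/asboolP.
by move=> y By fg; apply: no; exists y.
Qed.

Lemma avoidC f g : avoid f g = avoid g f.
Proof. by apply/setP => j; rewrite !inE; apply/asboolP/asboolP => H y /H; tauto. Qed.

Lemma det_cross a b c : det (vert b) (chord K a c) =
  (1 - b ^+ 2) * ((1 - a ^+ 2) * (1 - c ^+ 2)).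
Proof. by rewrite /det /=; ring. Qed.

(* The thickening gives room to push a point of a closed quadrant inside. *)
Lemma avoid_missing f g : (exists w, aff f w < 0 /\ aff g w < 0) ->
  avoid f g \subset missing A f g.
Proof.
move=> [w [fw gw]]; apply/fintype.subsetP => j; rewrite !inE => /asboolP av.
apply/asboolP => y Ay; apply: contrapT => /not_orP[/negP]; rewrite -leNgt => fy.
move=> /negP; rewrite -leNgt => gy.
pose m := `|w 0 0 - y 0 0| + `|w 0 1 - y 0 1|; have m0 : 0 <= m by rewrite addr_ge0.
(* Moving y towards w by the fraction t displaces each coordinate by at most [t * m <= e], so the
   result stays in the thickened set. *)
pose t := e / (e + m); have em : 0 < e + m by rewrite ltr_pwDl.
have t0 : 0 < t by rewrite divr_gt0.
have t1 : t <= 1 by rewrite ler_pdivrMr // mul1r lerDl.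
have tm : t * m <= e by rewrite /t mulrAC ler_pdivrMr // [e * (e + m)]mulrDr lerDr
  mulr_ge0 // ltW.
have near (x : R) : `|x| <= m -> `|t * x| <= e.
  by move=> xm; rewrite normrM gtr0_norm //; apply: le_trans tm; rewrite ler_pM2l.
apply: (av ((1 - t) *: y + t *: w)); last by split; rewrite aff_seg; nra.
exists y; split=> //; rewrite !mxE.
  rewrite (_ : _ - _ = t * (w 0 0 - y 0 0)); last by ring.
  by apply: near; rewrite lerDl.
rewrite (_ : _ - _ = t * (w 0 1 - y 0 1)); last by ring.
by apply: near; rewrite lerDr.
Qed.

Lemma nine_from_cross a b c : params a b c ->
    (forall i, two_faces A (avoid_quad a b c i)) ->
  exists F : seq {set I}, [/\ (size F <= 9)%N, {in F, forall S, face A S}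
    & forall j, exists2 S, S \in F & j \in S].
Proof.
move=> abc two.
pose S := [set j | [forall i, j \notin avoid_quad a b c i]]%SET.
have SP j i : j \in S -> meets_quad (B j) (quad K a b c i).1 (quad K a b c i).2.
  by rewrite inE => /forallP/(_ i)/avoidPn.
have fS : face A S.
  have [->|[j0 j0S]] := set_0Vmem S; first exact: face0.
  (* A set reaching all four open quadrants shows that none is empty above the parabola, so the
     cross is nondegenerate and has a unique centre. *)
  have gap0 i : gap a b c i != 0.
    apply/eqP => gi; have [y By yq] := SP j0 i j0S.
    by apply: (quad_empty abc gi _ yq); exact: B_inside By.
  have [a1 ab bc c1] := abc.
  have a_gt : -1 < a.
    by rewrite lt_neqAle a1 andbT eq_sym -subr_eq0 opprK; exact: (gap0 ord0).
  have c_lt : c < 1.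
    rewrite lt_neqAle c1 andbT eq_sym -subr_eq0.
    by have := gap0 (@Ordinal 4 3 isT).
  have v0 (s : R) : -1 < s -> s < 1 -> 1 - s ^+ 2 != 0.
    by move=> ? ?; rewrite gt_eqF //; nra.
  have fg : det (vert b) (chord K a c) != 0.
    by rewrite det_cross; apply: mulf_neq0; [|apply: mulf_neq0]; apply: v0; lra.
  have centre j : j \in S ->
      exists y, [/\ B j y, aff (vert b) y = 0 & aff (chord K a c) y = 0].
    move=> jS; apply: cvx_centre; first exact: thick_cvx.
    - exact: (SP j (@Ordinal 4 1 isT) jS).
    - exact: (SP j (@Ordinal 4 0 isT) jS).
    - exact: (SP j (@Ordinal 4 2 isT) jS).
    - exact: (SP j (@Ordinal 4 3 isT) jS).
  have [y [_ fy gy]] := centre j0 j0S.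
  apply: B_face; exists y => j /centre[z [Bz fz gz]].
  by rewrite (aff_det_inj fg (etrans fy (esym fz)) (etrans gy (esym gz))).
have [S1 /choice[S2 SF]] := choice two.
exists (S :: [seq S1 i | i : 'I_4] ++ [seq S2 i | i : 'I_4]); split.
- by rewrite /= size_cat !size_image card_ord.
- move=> T; rewrite inE mem_cat => /predU1P[->//|/orP[]/mapP[i _ ->]];
  by have [] := SF i.
move=> j; have [jS|] := boolP (j \in S); first by exists S; rewrite ?mem_head.
rewrite inE negb_forall => /existsP[i]; rewrite negbK => ji.
have [_ _ /fintype.subsetP/(_ j ji)] := SF i; rewrite finset.in_setU => /orP[] jS.
  by exists (S1 i) => //; rewrite inE mem_cat map_f ?mem_enum ?orbT.
by exists (S2 i) => //; rewrite inE mem_cat (map_f S2) ?mem_enum ?orbT.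
Qed.

(** Among two members of X and two of Y, any three include one of each family, so no three can have
    a common point. *)
Lemma cross_disjoint (X Y : {set I}) : (1 < #|X|)%N -> (1 < #|Y|)%N ->
  (forall i j y, i \in X -> j \in Y -> A i y -> A j y -> False) -> False.
Proof.
move=> /card_gt1P[i [i' [iX i'X ii']]] /card_gt1P[j [j' [jY j'Y jj']]] XY.
have ne k l : k \in X -> l \in Y -> k != l.
  move=> kX lY; apply/eqP => kl; have [y Ay] := A_ne k.
  by apply: (XY k l y kX lY Ay); rewrite -kl.
have /A43[[y []]|[y []]|[y []]|[y []]] : uniq [:: i; i'; j; j'].
  by rewrite /= !inE !negb_or ii' jj' !ne.
- by move=> Ai _ Aj; apply: (XY i j y).
- by move=> Ai _ Aj; apply: (XY i j' y).
- by move=> Ai Aj _; apply: (XY i j y).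
- by move=> Ai Aj _; apply: (XY i' j y).
Qed.

Lemma vert_shift s t y : (1 - s ^+ 2) * aff (vert t) y =
  (1 - t ^+ 2) * aff (vert s) y - (t - s) * (1 + s * t).
Proof. by rewrite /aff /=; ring. Qed.

Lemma vert_mono_ge s t y : -1 <= s -> s <= t -> t < 1 ->
  0 <= aff (vert t) y -> 0 <= aff (vert s) y.
Proof.
move=> s1 st t1 ty; have [ts|tn] := eqVneq t (-1).
  by have <- : t = s by lra.
have t_gt : -1 < t by rewrite lt_neqAle eq_sym tn; lra.
have vt : 0 < 1 - t ^+ 2 by nra.
have vs : 0 <= 1 - s ^+ 2 by nra.
have ? : 0 <= (t - s) * (1 + s * t) by rewrite mulr_ge0 ?subr_ge0 //; nra.
have ? : 0 <= (1 - s ^+ 2) * aff (vert t) y by rewrite mulr_ge0.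
by rewrite -(pmulr_rge0 _ vt); have := vert_shift s t y; lra.
Qed.

(** A point on the vertical line of parameter r, at any height. It provides the point interior to a
    half-plane or strip that [avoid_missing] asks for. *)
Lemma vert_witness r : -1 < r -> r < 1 -> exists w : V, forall s, -1 <= s <= 1 ->
  (r < s -> aff (vert s) w < 0) /\ (s < r -> 0 < aff (vert s) w).
Proof.
move=> r1 r2; have vr : 0 < 1 - r ^+ 2 by nra.
exists (\row_j (r / (1 - r ^+ 2))) => s /andP[s1 s2].
have sr : 0 < 1 + r * s.
  have ? : 0 <= (1 + r) * (1 + s) by apply: mulr_ge0; lra.
  have ? : 0 <= (1 - r) * (1 - s) by apply: mulr_ge0; lra.
  have [s0|s0] := leP s 0.
    have ? : 0 < (1 - r) * (1 - s) by apply: mulr_gt0; lra.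
    lra.
  have ? : 0 < (1 + r) * (1 + s) by apply: mulr_gt0; lra.
  lra.
have -> : aff (vert s) (\row_j (r / (1 - r ^+ 2))) =
    (r - s) * ((1 + r * s) / (1 - r ^+ 2)).
  by rewrite /aff !mxE /=; field; rewrite gt_eqF.
have k0 : 0 < (1 + r * s) / (1 - r ^+ 2) by rewrite divr_gt0.
split=> rs; first by rewrite pmulr_llt0 // subr_lt0.
by rewrite pmulr_lgt0 // subr_gt0.
Qed.

(** Members of L lie right of the line at s, members of N left of the line at t. By convexity a
    member of M lies left of s or right of t, disjoint from all of L or from all of N. Since M has
    at least three members, two are on the same side, which [cross_disjoint] excludes; for s = t
    already L and N are disjoint. *)
Lemma strips s t : -1 <= s -> s <= t -> t <= 1 ->
    ~ two_faces A (avoid (vert s) (vert t)) ->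
    ~ two_faces A (avoid (opf (vert s)) (vert t)) ->
  two_faces A (avoid (opf (vert s)) (opf (vert t))).
Proof.
move=> s1 st t1 nL nM; apply: contrapT => nR.
have sI : -1 <= s <= 1 by lra.
have tI : -1 <= t <= 1 by lra.
set L := avoid _ _ in nL; set M := avoid _ _ in nM; set N := avoid _ _ in nR.
have LP j y : j \in L -> A j y -> 0 < aff (vert s) y.
  move=> jL Ay; have [->|sn] := eqVneq s (-1); first by rewrite /aff /=; lra.
  have s_gt : -1 < s by rewrite lt_neqAle eq_sym sn.
  have [r1 r2] : -1 < (s - 1) / 2 /\ (s - 1) / 2 < 1 by split; lra.
  have [w wP] := vert_witness r1 r2.
  have /avoid_missing/fintype.subsetP/(_ j jL) jm : exists w,
    aff (vert s) w < 0 /\ aff (vert t) w < 0.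
    by exists w; split; apply: (wP _ _).1 => //; lra.
  rewrite ltNge; apply/negP => sy.
  by have := missingP jm Ay sy; have := vert_mono s1 st t1 sy; lra.
have NP j y : j \in N -> A j y -> aff (vert t) y < 0.
  move=> jN Ay; have [->|tn] := eqVneq t 1; first by rewrite /aff /=; lra.
  have t_lt : t < 1 by rewrite lt_neqAle tn.
  have [r1 r2] : -1 < (t + 1) / 2 /\ (t + 1) / 2 < 1 by split; lra.
  have [w wP] := vert_witness r1 r2.
  have /avoid_missing/fintype.subsetP/(_ j jN) jm : exists w,
    aff (opf (vert s)) w < 0 /\ aff (opf (vert t)) w < 0.
    by exists w; rewrite !aff_opf !oppr_lt0; split; apply: (wP _ _).2 => //; lra.
  rewrite ltNge; apply/negP => ty.
  have := vert_mono_ge s1 st t_lt ty => sy.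
  have := missingP jm Ay; rewrite !aff_opf; lra.
have L1 : (1 < #|L|)%N by exact: ltnW (two_faces_gt2 A_ne nL).
have N1 : (1 < #|N|)%N by exact: ltnW (two_faces_gt2 A_ne nR).
have [sE|sn] := eqVneq s t.
  apply: (cross_disjoint L1 N1) => i j y iL jN Ai Aj.
  by have := LP i y iL Ai; have := NP j y jN Aj; rewrite sE; lra.
have s_lt : s < t by rewrite lt_neqAle sn.
have [r1 r2] : -1 < (s + t) / 2 /\ (s + t) / 2 < 1 by split; lra.
have [w wP] := vert_witness r1 r2.
have MM : M \subset missing A (opf (vert s)) (vert t).
  apply: avoid_missing; exists w; rewrite aff_opf oppr_lt0.
  by split; [apply: (wP _ _).2|apply: (wP _ _).1] => //; lra.
have side j : j \in M -> (forall y, A j y -> aff (vert s) y < 0) \/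
    (forall y, A j y -> 0 < aff (vert t) y).
  move=> /(fintype.subsetP MM) jM;
    have [?|] := pselect (forall y, A j y -> aff (vert s) y < 0).
    by left.
  move=> nos; right => q Aq; rewrite ltNge; apply/negP => tq.
  apply: nos => p Ap; rewrite ltNge; apply/negP => sp.
  have sq : aff (vert s) q < 0.
    rewrite ltNge; apply/negP => sq; have := missingP jM Aq; rewrite aff_opf; lra.
  have [|u [_ _ Au su]] := cvx_zero (f := vert s) (@A_cvx j) Ap Aq; first by nra.
  have := missingP jM Au; rewrite aff_opf su oppr0 lexx => /(_ isT).
  have : aff (vert s) ((1 - u) *: p + u *: q) <= 0 by rewrite su.
  by move=> /(vert_mono s1 st t1); lra.
pose M1 := [set j in M | `[< forall y, A j y -> aff (vert s) y < 0 >]]%SET.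
have [M1_gt|M1_le] := ltnP 1 #|M1|.
  apply: (cross_disjoint L1 M1_gt) => i j y iL.
  rewrite inE => /andP[_ /asboolP jM] Ai Aj.
  by have := LP i y iL Ai; have := jM y Aj; lra.
have M2_gt : (1 < #|M :\: M1|)%N.
  have := two_faces_gt2 A_ne nM; rewrite -(cardsID M1 M).
  have : (#|M :&: M1| <= 1)%N.
    by apply: leq_trans M1_le; exact: subset_leq_card (finset.subsetIr _ _).
  by case: #|M :&: M1| => [|[|//]] _; rewrite ?add0n ?add1n // => /ltnW.
apply: (cross_disjoint N1 M2_gt) => i j y iN.
rewrite finset.in_setD => /andP[jM1 jM] Ai Aj.
have [jl|jr] := side j jM; last by have := NP i y iN Ai; have := jr y Aj; lra.
by move/negP: jM1; apply; rewrite inE jM; apply/asboolP.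
Qed.

(** For a = -1 the chord is the vertical line at c, for c = 1 it is the one at a with reversed sign;
    the cross is then a pair of verticals and [strips] applies. Otherwise the lines are transversal,
    all four quadrants are nonempty, and [quadrants] applies. *)
Lemma some_cross a b c : params a b c -> exists i, two_faces A (avoid_quad a b c i).
Proof.
move=> [a1 ab bc c1]; apply: contrapT => none.
have no i : ~ two_faces A (avoid_quad a b c i) by move=> ?; apply: none; exists i.
have := no (@Ordinal 4 0 isT); have := no (@Ordinal 4 1 isT).
have := no (@Ordinal 4 2 isT); have := no (@Ordinal 4 3 isT).
rewrite /avoid_quad /quad /=; move=> n3 n2 n1 n0 {none no}.
have avE f g g' : (forall y, aff g y = aff g' y) -> avoid f g = avoid f g'.
  by move=> gg; apply/setP => j; rewrite !inE; apply/asboolP/asboolP => H y /H;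
    rewrite gg.
have [aE|an] := eqVneq a (-1).
  have ch y : aff (chord K a c) y = aff (vert c) y.
    by rewrite chordE aE /aff /=; ring.
  have cho y : aff (opf (chord K a c)) y = aff (opf (vert c)) y.
    by rewrite !aff_opf ch.
  rewrite (avE _ _ _ ch) in n1; rewrite (avE _ _ _ ch) in n2.
  rewrite (avE _ _ _ cho) in n3.
  by apply: n3; apply: (@strips b c _ _ _ n1 n2) => //; lra.
have [cE|cn] := eqVneq c 1.
  have ch y : aff (chord K a c) y = aff (opf (vert a)) y.
    by rewrite chordE cE aff_opf /aff /=; ring.
  have cho y : aff (opf (chord K a c)) y = aff (vert a) y.
    by rewrite aff_opf ch aff_opf opprK.
  rewrite (avE _ _ _ ch) in n1; rewrite (avE _ _ _ ch) in n2.
  rewrite (avE _ _ _ cho) in n0.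
  rewrite avoidC in n0; rewrite avoidC in n1; rewrite avoidC in n2.
  by apply: n2; apply: (@strips a b _ _ _ n0 n1) => //; lra.
have v0 (s : R) : -1 < s -> s < 1 -> 1 - s ^+ 2 != 0 by move=> ? ?;
  rewrite gt_eqF //; nra.
have a_gt : -1 < a by rewrite lt_neqAle eq_sym an.
have c_lt : c < 1 by rewrite lt_neqAle cn.
have fg : det (vert b) (chord K a c) != 0.
  by rewrite det_cross; apply: mulf_neq0; [|apply: mulf_neq0]; apply: v0; lra.
have wit u v : exists w, aff (vert b) w = u /\ aff (chord K a c) w = v.
  exact: det_witness.
case: (quadrants A_cvx A_ne A43 fg) => H.
- apply: n1; apply: two_faces_sub H; apply: avoid_missing.
  by have [w [fw gw]] := wit (-1) (-1); exists w; rewrite fw gw ltrN10.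
- apply: n0; apply: two_faces_sub H; apply: avoid_missing.
  by have [w [fw gw]] := wit (-1) 1; exists w; rewrite aff_opf fw gw ltrN10.
- apply: n2; apply: two_faces_sub H; apply: avoid_missing.
  by have [w [fw gw]] := wit 1 (-1); exists w; rewrite aff_opf fw gw ltrN10.
- apply: n3; apply: two_faces_sub H; apply: avoid_missing.
  by have [w [fw gw]] := wit 1 1; exists w; rewrite !aff_opf fw gw ltrN10.
Qed.

Theorem nine_faces : exists F : seq {set I}, [/\ (size F <= 9)%N, {in F, forall S,
  face A S}
    & forall j, exists2 S, S \in F & j \in S].
Proof.
have [[S1 [S2 [f1 f2 S12]]]|nT] := pselect (two_faces A finset.setT).
  exists [:: S1; S2]; split=> // [S|j].
    by rewrite !inE => /orP[]/eqP ->.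
  have := fintype.subsetP S12 j (finset.in_setT j).
  rewrite finset.in_setU => /orP[]; [exists S1|exists S2] => //;
    by rewrite !inE eqxx ?orbT.
apply: contrapT => no; have [|a [b [c [abc nabc]]]] := limit_cross B_inside nT.
  move=> a b c abc; apply: contrapT => all; apply: no; apply: (nine_from_cross abc) => i.
  by apply: contrapT => ni; apply: all; exists i.
by have [i] := some_cross abc; exact: nabc.
Qed.

End Nine.

(** * From the nerve to the family *)

Lemma convex_set_cvx (R : realType) (X : set 'rV[R]_2) : convex_set X -> cvx X.
Proof.
move=> cX p q t Xp Xq t0 t1.
have := cX q p (Itv01 t0 t1) (mem_set Xq) (mem_set Xp).
by rewrite inE addrC.
Qed.

Lemma box_cvx (R : realType) (M : R) :
  cvx [set y : 'rV[R]_2 | `|y 0 0| <= M /\ `|y 0 1| <= M].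
Proof.
have H (u v t : R) : `|u| <= M -> `|v| <= M -> 0 <= t -> t <= 1 ->
  `|(1 - t) * u + t * v| <= M.
  rewrite !ler_norml => /andP[? ?] /andP[? ?] ? ?; apply/andP; split; nra.
by move=> p q t /= [p0 p1] [q0 q1] t0 t1; rewrite !mxE; split; apply: H.
Qed.

(* Replacing each set by the hull of chosen intersection points makes the
   family compact without changing its nerve. *)
Lemma pierce_finite (R : realType) (I : finType) (X : I -> set 'rV[R]_2) :
    (forall i, cvx (X i)) -> (forall i, X i !=set0) ->
    (forall i j k l, uniq [:: i; j; k; l] ->
      [\/ good X i j k, good X i j l, good X i k l | good X j k l]) ->
  exists s : seq 'rV[R]_2, (size s <= 9)%N /\ forall i, exists2 y, y \in s & X i y.
Proof.
move=> X_cvx X_ne X43.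
have [pt ptP] : exists pt : {set I} -> 'rV[R]_2,
    forall S i, face X S -> i \in S -> X i (pt S).
  have [S|pt ptP] := @choice {set I} 'rV[R]_2 (fun S y => face X S ->
    forall i, i \in S -> X i y).
    have [[y yP]|nS] := pselect (face X S); first by exists y.
    by exists 0.
  by exists pt => S i /ptP; apply.
pose pts i := map pt (seq.filter (fun S :
  {set I} => `[< face X S >] && (i \in S)) (enum {: {set I}})).
have ptsP i S : face X S -> i \in S -> pt S \in pts i.
  by move=> fS iS; apply: map_f; rewrite mem_filter mem_enum iS !andbT; apply/asboolP.
have ptsE i y : y \in pts i -> exists S, [/\ face X S, i \in S & y = pt S].
  by case/mapP => S; rewrite mem_filter => /andP[/andP[/asboolP ? ?] _] ->; exists S.
have pts_ne i : pts i != [::].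
  have : face X [set i]%SET by have [y Xy] := X_ne i; exists y => j;
    rewrite inE => /eqP ->.
  by move=> /ptsP/(_ (finset.set11 i)); case: (pts i).
have [A AP] := choice (fun i => hull_exists (pts_ne i)).
have A_cvx i : cvx (A i) by have [] := AP i.
have A_X i : A i `<=` X i.
  have [_ _ _ H] := AP i; apply: H => // _ /ptsE[S [fS iS ->]]; exact: ptP.
have A_face S : face X S -> face A S.
  move=> fS; exists (pt S) => i iS; have [_ _ H _] := AP i.
  by apply: H; exact: ptsP.
have A_ne i : A i !=set0.
  have [|y yP] := A_face [set i]%SET; last by exists y; apply: yP; exact: finset.set11.
  by have [y Xy] := X_ne i; exists y => j; rewrite inE => /eqP ->.
have A_good i j k : good X i j k -> good A i j k.
  move=> [y [Xi Xj Xk]]; have [|z zP] := A_face [set i; j; k]%SET.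
    by exists y => l; rewrite !inE => /orP[/orP[]|] /eqP ->.
  by exists z; split; apply: zP; rewrite !inE eqxx ?orbT.
have A43 i j k l : uniq [:: i; j; k; l] ->
    [\/ good A i j k, good A i j l, good A i k l | good A j k l].
  by case/X43 => /A_good; [constructor 1|constructor 2|constructor 3|constructor 4].
pose M := \big[Num.max/0]_(S : {set I}) Num.max `|pt S 0 0| `|pt S 0 1|.
have AM i y : A i y -> `|y 0 0| <= M /\ `|y 0 1| <= M.
  have [_ _ _ H] := AP i; apply: (H _ (@box_cvx R M)) => _ /ptsE[S [_ _ ->]] /=.
  have : Num.max `|pt S 0 0| `|pt S 0 1| <= M by exact: le_bigmax.
  by rewrite ge_max => /andP[].
have [e [e0 e1 eP]] := thick_nerve (fun i => let: And4 h _ _ _ := AP i in h) AM.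
(* The thickened sets lie in the box of half-side M + 1, where x ^ 2 <= (M + 1) ^ 2 and y >= - (M +
   1); this K puts the parabola below the box. *)
have inB i : inside ((M + 1) ^+ 2 + (M + 1)) (thick e (A i)).
  move=> y [a [/AM[a0 a1] ya0 ya1]]; move: a0 a1 ya0 ya1.
  rewrite !ler_norml => /andP[? ?] /andP[? ?] /andP[? ?] /andP[? ?].
  have : y 0 0 ^+ 2 <= (M + 1) ^+ 2.
    by rewrite -subr_ge0 subr_sqr mulr_ge0 //; lra.
  by lra.
have [F [F9 fF cF]] := nine_faces A_cvx A_ne A43 e0 eP inB.
exists (map pt F); split; first by rewrite size_map.
move=> i; have [S SF iS] := cF i; exists (pt S); first exact: map_f.
by apply: ptP => //; have [y yP] := fF S SF; exists y => j /yP/A_X.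
Qed.

Lemma pq_43_good (R : realType) (C : {fset (set 'rV[R]_2)}) (i j k l : C) :
    has_pq_property 4 3 C -> uniq [:: i; j; k; l] ->
  [\/ good val i j k, good val i j l, good val i k l | good (val : C ->
    set 'rV[R]_2) j k l].
Proof.
move=> C43 u4.
pose P := [fset x in map val [:: i; j; k; l]]%fset.
have PC : (P `<=` C)%fset.
  by apply/fsubsetP => x; rewrite !inE orbF => /or4P[]/eqP ->; exact: valP.
have P4 : #|` P| = 4.
  by rewrite card_fseq undup_id // map_inj_uniq //; exact: val_inj.
have [Q [QP Q3 [y yQ]]] := C43 P PC P4.
have PQ1 : (#|` (P `\` Q)%fset| <= 1)%N.
  by rewrite cardfsD (fsetIidPr QP) P4 Q3.
have inP m : m \in [:: i; j; k; l] -> val m \in P.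
  by move=> mP; apply/imfsetP; exists (val m) => /=; rewrite ?map_f.
have two m n : m \in [:: i; j; k; l] -> n \in [:: i; j; k; l] -> m != n ->
    val m \in Q \/ val n \in Q.
  move=> mP nP mn; have [|mQ] := boolP (val m \in Q); first by left.
  right; apply/negPn/negP => nQ; move: PQ1; rewrite leqNgt => /negP; apply.
  apply: (@leq_trans #|` [fset val m; val n]|)%fset.
    by rewrite cardfs2 (inj_eq val_inj) mn.
  apply: fsubset_leq_card; apply/fsubsetP => x.
  by move=> /fset2P[] ->; rewrite in_fsetD ?mQ ?nQ /= inP.
have g a b c : val a \in Q -> val b \in Q -> val c \in Q -> good (val : C -> set _) a b c.
  by move=> aQ bQ cQ; exists y; split; apply: yQ.
have [[ij ik il] [jk jl kl]] : [/\ i != j, i != k & i != l] /\ [/\ j != k,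
  j != l & k != l].
  by move: u4; rewrite /= !inE !negb_or !andbT => /and3P[/and3P[? ? ?] /andP[? ?] ?].
have [iQ|iQ] := boolP (val i \in Q); last first.
  constructor 4; apply: g.
  - by case: (two i j) => //; rewrite ?inE ?eqxx ?orbT // (negPf iQ).
  - by case: (two i k) => //; rewrite ?inE ?eqxx ?orbT // (negPf iQ).
  - by case: (two i l) => //; rewrite ?inE ?eqxx ?orbT // (negPf iQ).
have [jQ|jQ] := boolP (val j \in Q); last first.
  constructor 3; apply: g => //.
  - by case: (two j k) => //; rewrite ?inE ?eqxx ?orbT // (negPf jQ).
  - by case: (two j l) => //; rewrite ?inE ?eqxx ?orbT // (negPf jQ).
have [kQ|kQ] := boolP (val k \in Q); last first.
  constructor 2; apply: g => //.
  by case: (two k l) => //; rewrite ?inE ?eqxx ?orbT // (negPf kQ).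
by constructor 1; apply: g.
Qed.

Unset Implicit Arguments.

Theorem theorem1 (R : realType) (C : {fset (set 'rV[R]_2)})
    (C_nonempty : forall A : set 'rV[R]_2, A \in C -> A !=set0)
    (C_convex : forall A : set 'rV[R]_2, A \in C -> convex_set A)
    (C_43 : has_pq_property 4 3 C) :
  (piercing_number C <= 9%:E)%E.
Proof.
have [|||s [s9 sP]] := @pierce_finite R C (fun i => val i).
- by move=> i; apply: convex_set_cvx; apply: C_convex; exact: valP.
- by move=> i; apply: C_nonempty; exact: valP.
- by move=> i j k l; exact: pq_43_good.
apply: (@le_trans _ _ (#|` [fset x in s]%fset|%:R)%:E).
  apply: ereal_inf_lbound; exists [fset x in s]%fset => // A AC.
  by have [y ys Ay] := sP [` AC]%fset; exists y; split=> //=; rewrite inE.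
by rewrite lee_fin ler_nat (leq_trans _ s9) // card_fseq size_undup.
Qed.
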